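(* Let $H$ be a Hilbert space, $C,D\in\mathbb{R}_{>0}$, and let $F,G:\mathring{C}_\infty(\mathbb{R};H)\to\mathring{C}_\infty^+(\mathbb{R};H)'$ be such that for every $\varrho>\max\{C,D\}$ there exists $K>0$ with $$|F(u)(\psi)-F(w)(\psi)|\le C|\psi|_{-\varrho,0}|u-w|_{\varrho,0},\quad|G(u)(\psi)-G(w)(\psi)|\le D|\psi|_{-\varrho,0}|u-w|_{\varrho,0},$$ $$|F(0)(\psi)|\le K|\psi|_{-\varrho,0},\quad|G(0)(\psi)|\le K|\psi|_{-\varrho,0}$$ for all $u,w\in\mathring{C}_\infty(\mathbb{R};H)$, $\psi\in\mathring{C}_\infty^+(\mathbb{R};H)$. Let $\varrho>\max\{C,D\}$, $u_0,w_0\in H$, let $F_\varrho,G_\varrho$ be the continuous extensions of $F,G$ as mappings within $H_{\varrho,0}(\mathbb{R})\otimes H$, and let $u,w\in H_{\varrho,0}(\mathbb{R})\otimes H$ be solutions of $$\partial_{0,\varrho}u=F_\varrho(u)+\delta\otimes u_0\quad\text{and}\quad\partial_{0,\varrho}w=G_\varrho(w)+\delta\otimes w_0$$ in $H_{\varrho,-1}(\mathbb{R})\otimes H$. Then $$|u-w|_{\varrho,0}\le\frac{1}{2\varrho-(C+D)}\Big(\sqrt{2\varrho}\,|u_0-w_0|_H+2\sup_{x\in H_{\varrho,0}(\mathbb{R})\otimes H}|F_\varrho(x)-G_\varrho(x)|_{\varrho,0}\Big).$$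
   Context: $H$ is a Hilbert space over $\mathbb{K}\in\{\mathbb{R},\mathbb{C}\}$. For $\varrho\in\mathbb{R}$, $H_{\varrho,0}(\mathbb{R})\otimes H$ is the Hilbert space of (classes of) measurable $f:\mathbb{R}\to H$ with $|f|_{\varrho,0}^2=\int_{\mathbb{R}}|f(t)|_H^2e^{-2\varrho t}dt<\infty$. For $\varrho\ne0$, $\partial_{0,\varrho}$ is the derivative in $H_{\varrho,0}(\mathbb{R})\otimes H$ with domain $\{f: f'\in H_{\varrho,0}(\mathbb{R})\otimes H\}$ ($f'$ distributional derivative); $H_{\varrho,1}(\mathbb{R})\otimes H$ is its domain with norm $|f|_{\varrho,1}=|\partial_{0,\varrho}f|_{\varrho,0}$. $H_{\varrho,-1}(\mathbb{R})\otimes H$ is the space of continuous linear functionals on $H_{-\varrho,1}(\mathbb{R})\otimes H$, containing $H_{\varrho,0}(\mathbb{R})\otimes H$ via $f\mapsto(\psi\mapsto\int\langle f(t),\psi(t)\rangle_Hdt)$; $\partial_{0,\varrho}$ extends to a unitary operator from $H_{\varrho,0}(\mathbb{R})\otimes H$ onto $H_{\varrho,-1}(\mathbb{R})\otimes H$ by $(\partial_{0,\varrho}f)(\psi)=\int\langle f(t),-(\partial_{0,-\varrho}\psi)(t)\rangle_Hdt$. For $v\in H$, $\delta\otimes v:=\partial_{0,\varrho}(t\mapsto\chi_{\mathbb{R}_{>0}}(t)v)$. $\mathring{C}_\infty(\mathbb{R};H)$: smooth compactly supported $H$-valued functions; $\mathring{C}_\infty^+(\mathbb{R};H)$: smooth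 $\phi:\mathbb{R}\to H$ with $\sup\operatorname{supp}\phi<\infty$ and some derivative $\phi^{(n)}$ compactly supported; $\mathring{C}_\infty^+(\mathbb{R};H)'$: all linear maps $\mathring{C}_\infty^+(\mathbb{R};H)\to\mathbb{K}$; a functional $w$ with $|w(\psi)|\le c|\psi|_{-\varrho,0}$ is identified with the $f\in H_{\varrho,0}(\mathbb{R})\otimes H$ such that $w(\psi)=\int\langle f(t),\psi(t)\rangle_Hdt$. *)

(* Defs.v *)
From HB Require Import structures.
From mathcomp Require Import all_boot all_order all_algebra.
From mathcomp Require Import all_classical all_reals all_analysis.
From mathcomp Require Import complex.
Import Order.TTheory GRing.Theory Num.Theory.
Import numFieldNormedType.Exports.
Set Implicit Arguments. Unset Strict Implicit. Unset Printing Implicit Defensive.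
Local Open Scope classical_set_scope.
Local Open Scope ring_scope.

Definition scal (R : realType) (b : bool) : numFieldType :=
  if b then (R[i] : numFieldType) else (R : numFieldType).

Definition sconj (R : realType) (b : bool) : scal R b -> scal R b :=
  match b return scal R b -> scal R b with
  | true => fun z : R[i] => conjc z
  | false => fun z : R => z
  end.

Definition sre (R : realType) (b : bool) : scal R b -> R :=
  match b return scal R b -> R with
  | true => fun z : R[i] => complex.Re z
  | false => fun z : R => z
  end.

Definition sim (R : realType) (b : bool) : scal R b -> R :=
  match b return scal R b -> R with
  | true => fun z : R[i] => complex.Im z
  | false => fun _ => 0
  end.

Definition sofR (R : realType) (b : bool) : R -> scal R b :=
  match b return R -> scal R b with
  | true => fun x => Complex x 0
  | false => fun x => x
  end.

Definition kemb (R : realType) (b : bool) : R -> R -> scal R b :=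
  match b return R -> R -> scal R b with
  | true => fun x y => Complex x y
  | false => fun x _ => x
  end.

Definition kabs (R : realType) (b : bool) (z : scal R b) : R := sre `|z|.

Section Spaces.
Context (R : realType) (b : bool).
Local Notation K := (scal R b).
Context (H : lmodType K) (ip : H -> H -> K).

Definition hnorm (x : H) : R := Num.sqrt (sre (ip x x)).

Definition is_hilbert : Prop :=
  [/\ (forall (a : K) (x y z : H), ip x (a *: y + z) = a * ip x y + ip x z),
      (forall x y : H, ip y x = sconj (ip x y)),
      (forall x : H, 0 <= ip x x),
      (forall x : H, ip x x = 0 -> x = 0) &
      (forall s : nat -> H,
         (forall e : R, 0 < e -> exists N : nat, forall m n : nat,
             (N <= m)%N -> (N <= n)%N -> hnorm (s m - s n) < e) ->
         exists l : H, forall e : R, 0 < e -> exists N : nat, forall n : nat,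
             (N <= n)%N -> hnorm (s n - l) < e)].

Definition hderiv (f : R -> H) (t : R) (v : H) : Prop :=
  (fun h : R => hnorm ((sofR b h)^-1 *: (f (t + h) - f t) - v))
    @ dnbhs (0 : R) --> (0 : R).

Definition Cc (f : R -> H) : Prop :=
  (exists Dv : nat -> R -> H, Dv 0%N = f /\
     forall (n : nat) (t : R), hderiv (Dv n) t (Dv n.+1 t)) /\
  (exists M : R, forall t : R, M < `|t| -> f t = 0).

Definition Cplus (f : R -> H) : Prop :=
  exists Dv : nat -> R -> H,
  [/\ Dv 0%N = f,
      (forall (n : nat) (t : R), hderiv (Dv n) t (Dv n.+1 t)),
      (exists a : R, forall t : R, a < t -> f t = 0) &
      (exists (n : nat) (M : R), forall t : R, M < `|t| -> Dv n t = 0)].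

Definition smeas (f : R -> H) : Prop :=
  exists s : nat -> R -> H,
    (forall n : nat, finite_set (range (s n)) /\
       forall h : H, measurable (s n @^-1` [set h])) /\
    (forall t : R, (fun n => hnorm (s n t - f t)) @ \oo --> (0 : R)).

Definition wnorm2 (rho : R) (f : R -> H) : \bar R :=
  (\int[@lebesgue_measure R]_t ((hnorm (f t)) ^+ 2 * expR (- (2 * rho * t)))%:E)%E.

Definition L2w (rho : R) (f : R -> H) : Prop :=
  smeas f /\ (wnorm2 rho f < +oo)%E.

Definition wnorm (rho : R) (f : R -> H) : R := Num.sqrt (fine (wnorm2 rho f)).

Definition kint (g : R -> K) : K :=
  kemb b (Rintegral (@lebesgue_measure R) setT (fun t => sre (g t)))
         (Rintegral (@lebesgue_measure R) setT (fun t => sim (g t))).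

Definition pairing (f psi : R -> H) : K := kint (fun t => ip (f t) (psi t)).

Definition test_fun (phi : R -> R) : Prop :=
  (forall (n : nat) (x : R), derivable (iter n (@derive1 R R) phi) x 1) /\
  (exists M : R, forall t : R, M < `|t| -> phi t = 0).

Definition weak_deriv (psi g : R -> H) : Prop :=
  forall (h : H) (phi : R -> R), test_fun phi ->
    kint (fun t => ip (psi t) h * sofR b (derive1 phi t))
    = - kint (fun t => ip (g t) h * sofR b (phi t)).

Definition chi_pos (v : H) : R -> H := fun t => if 0 < t then v else 0.

Definition lin_functional_map (F : (R -> H) -> (R -> H) -> K) : Prop :=
  forall u : R -> H, Cc u ->
  forall (a : K) (psi1 psi2 : R -> H), Cplus psi1 -> Cplus psi2 ->
    F u (fun t => a *: psi1 t + psi2 t) = a * F u psi1 + F u psi2.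

Definition cont_ext (rho : R) (F : (R -> H) -> (R -> H) -> K)
    (Fr : (R -> H) -> R -> H) : Prop :=
  [/\ (forall x : R -> H, L2w rho x -> L2w rho (Fr x)),
      (forall x : R -> H, L2w rho x -> forall e : R, 0 < e ->
         exists2 d : R, 0 < d & forall y : R -> H, L2w rho y ->
           wnorm rho (fun t => y t - x t) < d ->
           wnorm rho (fun t => Fr y t - Fr x t) < e) &
      (forall u : R -> H, Cc u -> forall psi : R -> H, Cplus psi ->
         F u psi = pairing (Fr u) psi)].

(* u in H_{rho,0}(R)(x)H solves  d_{0,rho} u = Fr(u) + delta (x) u0
   in H_{rho,-1}(R)(x)H, i.e. as functionals on H_{-rho,1}(R)(x)H *)
Definition solves (rho : R) (Fr : (R -> H) -> R -> H) (u0 : H) (u : R -> H) : Prop :=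
  L2w rho u /\
  forall psi g : R -> H, L2w (- rho) psi -> L2w (- rho) g -> weak_deriv psi g ->
    pairing u (fun t => - g t)
    = pairing (Fr u) psi + pairing (chi_pos u0) (fun t => - g t).

End Spaces.

(* Main.v *)
(* The difference v of u - w and its jump part solves v' = f weakly, with
   f = F(u) - G(w).  Testing with exp (- 2 rho t) v gives the energy identity
   rho |v|^2 = Re <v, f>, hence rho |v| <= |f|; the jump part has norm
   |u0 - w0| / sqrt (2 rho).  On smooth compactly supported functions the
   Lipschitz bounds follow from duality, and they extend to all of L^2 by
   density, so |f| is bounded both by C |u - w| + sup |F - G| and by
   D |u - w| + sup |F - G|; average the two bounds.  Density is obtained from
   the bumps exp (- c / (t - p) - c / (q - t)) on ]p, q[, which tend to the
   indicator as c -> 0, and from a pi-lambda argument. *)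
Require Import Defs.
From HB Require Import structures.
From mathcomp Require Import all_boot all_order all_algebra.
From mathcomp Require Import all_classical all_reals all_analysis.
From mathcomp Require Import complex ring lra measurable_realfun.
Import Order.TTheory GRing.Theory Num.Theory.
Import numFieldNormedType.Exports.
Set Implicit Arguments.
Unset Strict Implicit.
Unset Printing Implicit Defensive.
Local Open Scope classical_set_scope.
Local Open Scope ring_scope.

(** The jump must go before testing: unless [u0 = w0], the derivative of exp (- 2 rho t) (u - w)
    contains a delta, so this function is not admissible in the equation. Once the jump part z is
    subtracted, the derivative is a function. That exp (- 2 rho t) v is admissible is itself read
    off the equation: weak derivatives are tested with scalar functions phi times vectors h, and the
    equation for v may be tested with exp (- 2 rho t) phi h. The constant arises by doubling rho |u
    - w| <= rho |v| + rho |z|: here 2 rho |v| <= 2 |f| <= (C + D) |u - w| + 2 sup |F - G|, the term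
    (C + D) |u - w| is absorbed on the left since rho > max (C, D), and 2 rho |z| = sqrt (2 rho) |u0
    - w0|. Density enters twice: F and its extension are related only on smooth arguments and smooth
    test functions, so both the norm of a difference of values and the arguments themselves have to
    be reached from smooth functions. As H may be nonseparable, measurability always means being a
    pointwise limit of simple functions. *)

Section Scalars.
Context (R : realType) (b : bool).
Local Notation K := (scal R b).
Implicit Types (x y z : K) (r s : R).

Lemma scal_ext x y : sre x = sre y -> sim x = sim y -> x = y.
Proof. by case: b x y => //= -[x1 x2] [y1 y2] /= -> ->. Qed.

Lemma sreD x y : sre (x + y) = sre x + sre y.
Proof. by case: b x y => //= -[x1 x2] [y1 y2]. Qed.

Lemma sreN x : sre (- x) = - sre x.
Proof. by case: b x => //= -[x1 x2]. Qed.

Lemma simN x : sim (- x) = - sim x.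
Proof. by case: b x => /= [[x1 x2]//|x]; rewrite oppr0. Qed.

Lemma sreZ r x : sre (sofR b r * x) = r * sre x.
Proof. by case: b x => //= -[x1 x2] /=; rewrite mul0r subr0. Qed.

Lemma simZ r x : sim (sofR b r * x) = r * sim x.
Proof. by case: b x => /= [[x1 x2]|x]; rewrite ?mulr0//= mul0r addr0. Qed.

Lemma sre_conj x : sre (sconj x) = sre x.
Proof. by case: b x => //= -[]. Qed.

Lemma sofRD r s : sofR b (r + s) = sofR b r + sofR b s.
Proof. by case: b => //=; apply/eqP; rewrite eq_complex /= addr0 !eqxx. Qed.

Lemma sofRN r : sofR b (- r) = - sofR b r.
Proof. by case: b => //=; apply/eqP; rewrite eq_complex /= oppr0 !eqxx. Qed.

Lemma sofRM r s : sofR b (r * s) = sofR b r * sofR b s.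
Proof.
case: b => //=; apply/eqP.
by rewrite eq_complex /= !mulr0 mul0r subr0 addr0 !eqxx.
Qed.

Lemma sofR1 : sofR b (1 : R) = 1.
Proof. by case: b. Qed.

Lemma sofR0 : sofR b (0 : R) = 0.
Proof. by case: b. Qed.

Lemma sofRV r : sofR b r^-1 = (sofR b r)^-1.
Proof.
have [->|r0] := eqVneq r 0; first by rewrite !(invr0, sofR0).
have E : sofR b r * sofR b r^-1 = 1 by rewrite -sofRM divff // sofR1.
have r0' : sofR b r != 0.
  by apply/eqP => z0; move/eqP: E; rewrite z0 mul0r eq_sym oner_eq0.
by apply: (mulfI r0'); rewrite E divff.
Qed.

Lemma sre_kabs z : `|sre z| <= kabs z.
Proof.
rewrite /kabs; case: b z => //= -[x y] /=.
by rewrite -[leLHS]sqrtr_sqr ler_wsqrtr // lerDl sqr_ge0.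
Qed.

Lemma scal_ge0 z : 0 <= z -> 0 <= sre z /\ sim z = 0.
Proof.
by case: b z => //= -[x y]; rewrite lecE /= => /andP[/eqP -> ->].
Qed.

(* Reduces statements on imaginary parts of inner products to real parts. *)
Lemma sim_sre : exists c : K, forall z, sim z = sre (c * z).
Proof.
case: b; last by exists 0 => z; rewrite mul0r.
by exists (Complex 0 (-1)) => -[x y] /=; rewrite mul0r sub0r mulN1r opprK.
Qed.

Lemma sre_kint (g : R -> K) :
  sre (kint g) = \int[@lebesgue_measure R]_t sre (g t).
Proof. by case: b g. Qed.

Lemma sim_kint (g : R -> K) :
  sim (kint g) = \int[@lebesgue_measure R]_t sim (g t).
Proof. by case: b g => //= g; rewrite /Rintegral integral0. Qed.

End Scalars.

Lemma quadratic_CS (R : realFieldType) (p q r : R) : 0 <= p ->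
  (forall s, 0 <= s ^+ 2 * p + s * (2 * q) + r) -> q ^+ 2 <= p * r.
Proof.
rewrite le_eqVlt => /orP[/eqP <-|p0] h.
  have [->|q0] := eqVneq q 0; first by rewrite expr0n /= mul0r.
  (* With [p = 0] the form is affine in [s], and this [s] would give it the value [-1]. *)
  have := h (- (r + 1) / (2 * q)).
  rewrite mulr0 add0r divfK ?mulf_neq0 //; lra.
(* [- q / p] is the minimiser of the quadratic form. *)
have := h (- q / p).
rewrite -(pmulr_rge0 _ p0).
have -> : p * ((- q / p) ^+ 2 * p + - q / p * (2 * q) + r) = p * r - q ^+ 2.
  by field; rewrite gt_eqF.
by rewrite subr_ge0.
Qed.

(** * The underlying real inner product space *)

Section HilbertSpace.
Context (R : realType) (b : bool) (H : lmodType (scal R b)).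
Context (ip : H -> H -> scal R b) (hH : is_hilbert ip).
Implicit Types (x y z : H) (r s : R).

(** The real part keeps the norm and makes [H] a real inner product space, so the real and the
    complex case share their estimates; [rscale] is the matching real scalar action. *)
Definition rip x y : R := sre (ip x y).
Definition rscale r x : H := sofR b r *: x.

Lemma rscaleDl r s x : rscale (r + s) x = rscale r x + rscale s x.
Proof. by rewrite /rscale sofRD scalerDl. Qed.

Lemma rscaleA r s x : rscale r (rscale s x) = rscale (r * s) x.
Proof. by rewrite /rscale sofRM scalerA. Qed.

Lemma rscale1 x : rscale 1 x = x.
Proof. by rewrite /rscale sofR1 scale1r. Qed.

Lemma rscale0 x : rscale 0 x = 0.
Proof. by rewrite /rscale sofR0 scale0r. Qed.

Lemma rscaleN1 x : rscale (- 1) x = - x.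
Proof. by rewrite /rscale sofRN sofR1 scaleN1r. Qed.

Lemma ipDr x y z : ip x (y + z) = ip x y + ip x z.
Proof. by case: hH => h _ _ _ _; have := h 1 x y z; rewrite scale1r mul1r. Qed.

Lemma ip0r x : ip x 0 = 0.
Proof. by apply: (addIr (ip x 0)); rewrite -ipDr addr0 add0r. Qed.

Lemma ipZr a x y : ip x (a *: y) = a * ip x y.
Proof.
by case: hH => h _ _ _ _; have := h a x y 0; rewrite ip0r !addr0.
Qed.

Lemma ip_conj x y : ip y x = sconj (ip x y).
Proof. by case: hH. Qed.

Lemma ripC x y : rip x y = rip y x.
Proof. by rewrite /rip ip_conj sre_conj. Qed.

Lemma ripDr x y z : rip x (y + z) = rip x y + rip x z.
Proof. by rewrite /rip ipDr sreD. Qed.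

Lemma ripDl x y z : rip (y + z) x = rip y x + rip z x.
Proof. by rewrite !(ripC _ x) ripDr. Qed.

Lemma ripZr r x y : rip x (rscale r y) = r * rip x y.
Proof. by rewrite /rip ipZr sreZ. Qed.

Lemma ripZl r x y : rip (rscale r x) y = r * rip x y.
Proof. by rewrite ripC ripZr ripC. Qed.

Lemma ripNr x y : rip x (- y) = - rip x y.
Proof. by rewrite -rscaleN1 ripZr mulN1r. Qed.

Lemma ripNl x y : rip (- x) y = - rip x y.
Proof. by rewrite ripC ripNr ripC. Qed.

Lemma rip_ge0 x : 0 <= rip x x.
Proof. by case: hH => _ _ h _ _; have [] := scal_ge0 (h x). Qed.

Lemma hnorm_sqr x : hnorm ip x ^+ 2 = rip x x.
Proof. by rewrite sqr_sqrtr // rip_ge0. Qed.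

Lemma hnorm_ge0 x : 0 <= hnorm ip x.
Proof. exact: sqrtr_ge0. Qed.

Lemma hnormZ r x : hnorm ip (rscale r x) = `|r| * hnorm ip x.
Proof.
rewrite /hnorm -/(rip _ _) ripZl ripZr mulrA -expr2.
by rewrite sqrtrM ?sqr_ge0 // sqrtr_sqr.
Qed.

Lemma hnormN x : hnorm ip (- x) = hnorm ip x.
Proof. by rewrite -rscaleN1 hnormZ normrN normr1 mul1r. Qed.

Lemma hnorm0 : hnorm ip 0 = 0.
Proof. by rewrite -(rscale0 0) hnormZ normr0 mul0r. Qed.

Lemma hnorm_eq0 x : hnorm ip x = 0 -> x = 0.
Proof.
move=> x0; case: hH => _ _ ge0 h _; apply: h.
have [_ i0] := scal_ge0 (ge0 x).
have r0 : rip x x = 0 by rewrite -hnorm_sqr x0 expr0n.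
by apply: scal_ext; rewrite ?i0 ?[LHS]r0; case: (b).
Qed.

Lemma hnorm_CS x y : `|rip x y| <= hnorm ip x * hnorm ip y.
Proof.
rewrite -sqrtr_sqr /hnorm -sqrtrM ?rip_ge0 //; apply: ler_wsqrtr.
apply: quadratic_CS => [|s]; first exact: rip_ge0.
have := rip_ge0 (rscale s x + y).
rewrite !(ripDl, ripDr, ripZl, ripZr) (ripC y x) => h.
suff -> : s ^+ 2 * sre (ip x x) + s * (2 * rip x y) + sre (ip y y) =
  s * (s * rip x x) + s * rip x y + (s * rip x y + rip y y) by [].
rewrite /rip; ring.
Qed.

Lemma hnormD x y : hnorm ip (x + y) <= hnorm ip x + hnorm ip y.
Proof.
rewrite -(@ler_pXn2r _ 2) ?nnegrE ?addr_ge0 ?hnorm_ge0 //.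
rewrite sqrrD !hnorm_sqr ripDl !ripDr (ripC y x).
by have := le_trans (ler_norm _) (hnorm_CS x y); lra.
Qed.

Lemma hnormB x y : hnorm ip (x - y) = hnorm ip (y - x).
Proof. by rewrite -hnormN opprB. Qed.

Lemma ler_dist_hnorm x y : `|hnorm ip x - hnorm ip y| <= hnorm ip (x - y).
Proof.
have := hnormD (x - y) y; have := hnormD (y - x) x.
rewrite !subrK (hnormB y x) ler_norml; lra.
Qed.

(** Polarization reduces measurability of inner products to that of norms. *)
Lemma rip_polar x y :
  rip x y = (hnorm ip (x + y) ^+ 2 - hnorm ip (x - y) ^+ 2) / 4.
Proof.
rewrite !hnorm_sqr !(ripDl, ripDr, ripNl, ripNr) (ripC y x).
by field.
Qed.

End HilbertSpace.

(** * Simple functions and strong measurability *)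

Section SimpleFunctions.
Import HBSimple.
Context (R : realType).

(** Only level sets are required to be measurable, so [T] needs no sigma-algebra and the notion
    applies to values in [H], in [R] and in [bool] alike. *)
Definition simple (T : Type) (s : R -> T) : Prop :=
  finite_set (range s) /\ forall y, measurable (s @^-1` [set y]).

Lemma simple_op2 (T1 T2 T : Type) (op : T1 -> T2 -> T) (s1 : R -> T1)
    (s2 : R -> T2) :
  simple s1 -> simple s2 -> simple (fun t => op (s1 t) (s2 t)).
Proof.
move=> [f1 m1] [f2 m2]; split => [|y].
  apply: (sub_finite_set _ (finite_image2 op f1 f2)) => _ [t _ <-] /=.
  by exists (s1 t); [exists t|exists (s2 t); [exists t|]].
rewrite (_ : _ @^-1` _ = \bigcup_(p in (range s1 `*` range s2) `&`
    [set p | op p.1 p.2 = y]) (s1 @^-1` [set p.1] `&` s2 @^-1` [set p.2])).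
  apply: fin_bigcup_measurable => [|p _]; last exact: measurableI.
  exact: (sub_finite_set (@subIsetl _ _ _) (finite_setX f1 f2)).
apply/seteqP; split => [t /= <-|t [[p1 p2] /= [_ <-] [-> ->]]//].
by exists (s1 t, s2 t) => //=; split => //; split; exists t.
Qed.

Lemma simple_cst (T : Type) (y : T) : simple (fun _ => y).
Proof.
split => [|z].
  by apply: (sub_finite_set _ (finite_set1 y)) => _ [t _ <-].
have [->|yz] := pselect (y = z).
  by rewrite (_ : _ @^-1` _ = setT) //; apply/seteqP; split.
rewrite (_ : _ @^-1` _ = set0) //; apply/seteqP; split => //.
Qed.

Lemma simple_op1 (T1 T : Type) (op : T1 -> T) (s1 : R -> T1) :
  simple s1 -> simple (op \o s1).
Proof.
by move=> h; exact: (simple_op2 (fun x _ => op x) h (simple_cst tt)).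
Qed.

Lemma simple_measurable_fun (s : R -> R) : simple s -> measurable_fun setT s.
Proof.
move=> [fs ms] _ Y mY; rewrite setTI.
rewrite (_ : _ @^-1` _ = \bigcup_(y in range s `&` Y) (s @^-1` [set y])).
  apply: fin_bigcup_measurable => //.
  exact: (sub_finite_set (@subIsetl _ _ _) fs).
apply/seteqP; split => [t /= Yt|t [y [_ Yy] /= ->]//].
by exists (s t) => //; split => //; exists t.
Qed.

Lemma measurable_approx (f : R -> R) : measurable_fun setT f ->
  exists s : nat -> R -> R, (forall n, simple (s n)) /\
    forall t, s ^~ t @ \oo --> f t.
Proof.
move=> mf; have mEf : measurable_fun setT (EFin \o f).
  exact: measurableT_comp.
have [g cg] := approximation_sfun measurableT mEf.
exists (fun n => g n); split=> [n|t].
  by split=> [|y]; [exact: fimfunP|exact: measurable_funPTI].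
by have /fine_cvgP [_] := cg t I.
Qed.

End SimpleFunctions.

Section StronglyMeasurable.
Context (R : realType) (b : bool) (H : lmodType (scal R b)).
Context (ip : H -> H -> scal R b) (hH : is_hilbert ip).
Local Notation hn := (hnorm ip).
Implicit Types (f g : R -> H) (phi : R -> R).

Lemma smeas_cst (h : H) : smeas ip (fun _ => h).
Proof.
exists (fun _ _ => h); split => [n|t]; first exact: simple_cst.
by under eq_fun do rewrite subrr (hnorm0 hH); exact: cvg_cst.
Qed.

Lemma smeasD f g : smeas ip f -> smeas ip g -> smeas ip (fun t => f t + g t).
Proof.
move=> [s [ss cs]] [s' [ss' cs']].
exists (fun n t => s n t + s' n t); split => [n|t].
  exact: (simple_op2 +%R (ss n) (ss' n)).
apply: (@squeeze_cvgr _ _ _ _ (fun=> 0)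
  (fun n => hn (s n t - f t) + hn (s' n t - g t))).
- by apply: nearW => n; rewrite hnorm_ge0 /= opprD addrACA hnormD.
- exact: cvg_cst.
- by rewrite -[0]addr0; apply: cvgD.
Qed.

Lemma smeas_rscale phi f : measurable_fun setT phi -> smeas ip f ->
  smeas ip (fun t => rscale (phi t) (f t)).
Proof.
move=> /measurable_approx [p [sp cp]] [s [ss cs]].
exists (fun n t => rscale (p n t) (s n t)); split => [n|t].
  exact: (simple_op2 (@rscale R b H) (sp n) (ss n)).
apply: (@squeeze_cvgr _ _ _ _ (fun=> 0)
  (fun n => `|p n t| * hn (s n t - f t) + `|p n t - phi t| * hn (f t))).
- apply: nearW => n; rewrite hnorm_ge0 /= -!hnormZ //.
  apply: le_trans (hnormD hH _ _).
  by rewrite /rscale sofRD sofRN scalerBr scalerDl scaleNr addrA subrK.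
- exact: cvg_cst.
- have -> : 0 = `|phi t| * 0 + 0 * hn (f t) by rewrite mulr0 mul0r addr0.
  apply: cvgD; apply: cvgM => //; first by apply: cvg_norm.
    rewrite -(normr0 R) -(subrr (phi t)); apply: cvg_norm; apply: cvgB => //.
    exact: cvg_cst.
  exact: cvg_cst.
Qed.

Lemma smeasN f : smeas ip f -> smeas ip (fun t => - f t).
Proof.
move=> mf; under eq_fun do rewrite -rscaleN1.
by apply: smeas_rscale => //; exact: measurable_cst.
Qed.

Lemma smeasB f g : smeas ip f -> smeas ip g -> smeas ip (fun t => f t - g t).
Proof. by move=> mf mg; apply: smeasD => //; exact: smeasN. Qed.

Lemma measurable_hnorm f : smeas ip f ->
  measurable_fun setT (fun t => hn (f t)).
Proof.
move=> [s [ss cs]].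
apply: (@measurable_fun_cvg _ _ _ _ (fun n t => hn (s n t))) => [n|t _].
  exact: simple_measurable_fun (simple_op1 hn (ss n)).
apply/cvgrPdist_lt => e e0.
have /cvgrPdist_lt /(_ e e0) := cs t.
apply: filterS => n; rewrite sub0r normrN ger0_norm ?hnorm_ge0 //.
by apply: le_lt_trans; rewrite distrC ler_dist_hnorm.
Qed.

Lemma measurable_rip f g : smeas ip f -> smeas ip g ->
  measurable_fun setT (fun t => rip ip (f t) (g t)).
Proof.
move=> mf mg; under eq_fun do rewrite (rip_polar hH).
apply: measurable_funM; last exact: measurable_cst.
apply: measurable_funB; apply: measurable_funX; apply: measurable_hnorm.
  exact: smeasD.
exact: smeasB.
Qed.

End StronglyMeasurable.

(** * Weighted L^2 spaces *)

Section WeightedL2.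
Context (R : realType) (b : bool) (H : lmodType (scal R b)).
Context (ip : H -> H -> scal R b) (hH : is_hilbert ip).
Local Notation hn := (hnorm ip).
Local Notation mu := (@lebesgue_measure R).
Implicit Types (f g : R -> H) (rho a r : R).

Definition weight rho (t : R) : R := expR (- (2 * rho * t)).

Lemma weight_gt0 rho t : 0 < weight rho t.
Proof. exact: expR_gt0. Qed.

Lemma measurable_weight rho : measurable_fun setT (weight rho).
Proof.
apply: measurableT_comp; first exact: measurable_expR.
apply: measurable_funN; apply: measurable_funM => //.
Qed.

(** Real part of the inner product of the space with weight [rho]. Since [Rintegral] is total, the
    bilinearity rules ask for [L2w], which supplies integrability. *)
Definition wip rho f g : R := \int[mu]_t (rip ip (f t) (g t) * weight rho t).

Lemma measurable_wip rho f g : smeas ip f -> smeas ip g ->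
  measurable_fun setT (fun t => rip ip (f t) (g t) * weight rho t).
Proof.
move=> mf mg; apply: measurable_funM; last exact: measurable_weight.
exact: measurable_rip.
Qed.

Lemma L2w_smeas rho f : L2w ip rho f -> smeas ip f.
Proof. by case. Qed.

Lemma L2wP rho f : L2w ip rho f <->
  smeas ip f /\
  mu.-integrable setT (EFin \o (fun t => rip ip (f t) (f t) * weight rho t)).
Proof.
have E : wnorm2 ip rho f =
    (\int[mu]_t `|(rip ip (f t) (f t) * weight rho t)%:E|)%E.
  apply: eq_integral => t _.
  by rewrite hnorm_sqr // gee0_abs // lee_fin mulr_ge0 ?rip_ge0 // expR_ge0.
split=> -[mf] fi; split => //.
  apply/integrableP; split; last by rewrite -E.
  by apply/measurable_EFinP; exact: measurable_wip.
by rewrite E; case/integrableP: fi.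
Qed.

Lemma L2w_le rho c f g : smeas ip f -> L2w ip rho g ->
  (forall t, hn (f t) <= c * hn (g t)) -> L2w ip rho f.
Proof.
move=> mf /L2wP[mg ig] fg; apply/L2wP; split => //.
apply: le_integrable (integrableZl measurableT (c ^+ 2) ig) => //.
  by apply/measurable_EFinP; exact: measurable_wip.
move=> t _ /=; rewrite lee_fin.
rewrite !ger0_norm ?(sqr_ge0, mulr_ge0, rip_ge0, expR_ge0) //.
rewrite mulrA ler_wpM2r ?expR_ge0 // -!hnorm_sqr // -exprMn.
by rewrite ler_pXn2r ?nnegrE ?hnorm_ge0 // (le_trans _ (fg t)) ?hnorm_ge0.
Qed.

Lemma L2wZ rho r f : L2w ip rho f -> L2w ip rho (fun t => rscale r (f t)).
Proof.
move=> lf; apply: (@L2w_le _ `|r| _ f) => // [|t]; last by rewrite hnormZ.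
by apply: smeas_rscale => //; exact: L2w_smeas lf.
Qed.

Lemma L2wN rho f : L2w ip rho f -> L2w ip rho (fun t => - f t).
Proof.
by move=> lf; under eq_fun do rewrite -rscaleN1; exact: L2wZ.
Qed.

Lemma L2wD rho f g : L2w ip rho f -> L2w ip rho g ->
  L2w ip rho (fun t => f t + g t).
Proof.
move=> /L2wP[mf fi] /L2wP[mg gi]; apply/L2wP; split; first exact: smeasD.
have := integrableZl measurableT 2 (integrableD measurableT fi gi).
apply: le_integrable => //.
  by apply/measurable_EFinP; apply: measurable_wip => //; exact: smeasD.
move=> t _ /=; rewrite lee_fin.
have w0 := weight_gt0 rho t.
rewrite !ger0_norm ?mulr_ge0 ?addr_ge0 ?mulr_ge0 ?rip_ge0 ?(ltW w0) //.
rewrite -mulrDl mulrA ler_pM2r //.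
(* Positivity at f - g amounts to |f + g|^2 <= 2 (|f|^2 + |g|^2). *)
have := rip_ge0 hH (f t - g t).
rewrite !(ripDl, ripDr, ripNl, ripNr) // (ripC hH (g t) (f t)); lra.
Qed.

Lemma L2wB rho f g : L2w ip rho f -> L2w ip rho g ->
  L2w ip rho (fun t => f t - g t).
Proof. by move=> lf lg; apply: L2wD => //; exact: L2wN. Qed.

Lemma wip_integrable rho f g : L2w ip rho f -> L2w ip rho g ->
  mu.-integrable setT (EFin \o (fun t => rip ip (f t) (g t) * weight rho t)).
Proof.
move=> /L2wP[mf fi] /L2wP[mg gi].
have := integrableD measurableT fi gi.
apply: le_integrable => //.
  by apply/measurable_EFinP; exact: measurable_wip.
move=> t _ /=; rewrite lee_fin.
have w0 := weight_gt0 rho t.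
rewrite [leRHS]ger0_norm ?addr_ge0 ?mulr_ge0 ?rip_ge0 ?(ltW w0) //.
rewrite -mulrDl normrM (gtr0_norm w0) ler_pM2r //.
(* Positivity at f - g and f + g bounds 2 <f, g> from both sides by |f|^2 + |g|^2. *)
have := rip_ge0 hH (f t - g t); have := rip_ge0 hH (f t + g t).
have := rip_ge0 hH (f t); have := rip_ge0 hH (g t).
rewrite !(ripDl, ripDr, ripNl, ripNr) // (ripC hH (g t) (f t)) ler_norml; lra.
Qed.

Lemma wipC rho f g : wip rho f g = wip rho g f.
Proof. by apply: eq_Rintegral => t _; rewrite ripC. Qed.

Lemma wipDl rho f f' g : L2w ip rho f -> L2w ip rho f' -> L2w ip rho g ->
  wip rho (fun t => f t + f' t) g = wip rho f g + wip rho f' g.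
Proof.
move=> lf lf' lg; rewrite /wip.
under eq_Rintegral do rewrite ripDl // mulrDl.
by apply: RintegralD => //; exact: wip_integrable.
Qed.

Lemma wipDr rho f g g' : L2w ip rho f -> L2w ip rho g -> L2w ip rho g' ->
  wip rho f (fun t => g t + g' t) = wip rho f g + wip rho f g'.
Proof. by move=> lf lg lg'; rewrite wipC wipDl // !(wipC _ f). Qed.

Lemma wipZl rho r f g : L2w ip rho f -> L2w ip rho g ->
  wip rho (fun t => rscale r (f t)) g = r * wip rho f g.
Proof.
move=> lf lg; rewrite /wip.
under eq_Rintegral do rewrite ripZl // -mulrA.
by apply: RintegralZl => //; exact: wip_integrable.
Qed.

Lemma wipZr rho r f g : L2w ip rho f -> L2w ip rho g ->
  wip rho f (fun t => rscale r (g t)) = r * wip rho f g.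
Proof. by move=> lf lg; rewrite wipC wipZl // wipC. Qed.

Lemma wip_ge0 rho f : 0 <= wip rho f f.
Proof.
by apply: Rintegral_ge0 => t _; rewrite mulr_ge0 ?rip_ge0 // expR_ge0.
Qed.

Lemma wnormE rho f : wnorm ip rho f = Num.sqrt (wip rho f f).
Proof.
congr (Num.sqrt (fine _)); apply: eq_integral => t _.
by rewrite hnorm_sqr.
Qed.

Lemma wnorm_sqr rho f : wnorm ip rho f ^+ 2 = wip rho f f.
Proof. by rewrite wnormE sqr_sqrtr // wip_ge0. Qed.

Lemma wnorm_ge0 rho f : 0 <= wnorm ip rho f.
Proof. exact: sqrtr_ge0. Qed.

Lemma wip_CS rho f g : L2w ip rho f -> L2w ip rho g ->
  `|wip rho f g| <= wnorm ip rho f * wnorm ip rho g.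
Proof.
move=> lf lg; rewrite -sqrtr_sqr !wnormE -sqrtrM ?wip_ge0 //.
apply: ler_wsqrtr; apply: quadratic_CS => [|s]; first exact: wip_ge0.
have := wip_ge0 rho (fun t => rscale s (f t) + g t).
have lsf := L2wZ s lf.
rewrite wipDl ?wipDr ?wipZl ?wipZr //; last exact: L2wD.
rewrite ?wipZl // (wipC _ g f); lra.
Qed.

Lemma wnormD rho f g : L2w ip rho f -> L2w ip rho g ->
  wnorm ip rho (fun t => f t + g t) <= wnorm ip rho f + wnorm ip rho g.
Proof.
move=> lf lg; have := wip_CS lf lg.
rewrite ler_norml => /andP[_ h].
rewrite -(@ler_pXn2r _ 2) ?nnegrE ?addr_ge0 ?wnorm_ge0 //.
rewrite sqrrD !wnorm_sqr wipDl ?wipDr ?(wipC _ g f) //; last exact: L2wD.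
lra.
Qed.

Lemma wnormB rho f g :
  wnorm ip rho (fun t => f t - g t) = wnorm ip rho (fun t => g t - f t).
Proof.
rewrite !wnormE; congr Num.sqrt; apply: eq_Rintegral => t _.
by rewrite -(opprB (g t)) ripNl // ripNr // opprK.
Qed.

Lemma wnorm_trans rho f g h : L2w ip rho f -> L2w ip rho g -> L2w ip rho h ->
  wnorm ip rho (fun t => f t - h t) <=
  wnorm ip rho (fun t => f t - g t) + wnorm ip rho (fun t => g t - h t).
Proof.
move=> lf lg lh; apply: le_trans (wnormD (L2wB lf lg) (L2wB lg lh)).
by under [in leRHS]eq_fun do rewrite addrA subrK.
Qed.

(** Multiplication by an exponential is an isometry from weight [rho] to weight [rho + a]; it moves
    both sides of a duality into a single space. *)
Definition reweight a f : R -> H := fun t => rscale (expR (a * t)) (f t).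

Lemma weight_reweight rho a t :
  expR (a * t) * expR (a * t) * weight (rho + a) t = weight rho t.
Proof. by rewrite /weight -!expRD; congr expR; ring. Qed.

Lemma measurable_expRM a : measurable_fun setT (fun t : R => expR (a * t)).
Proof.
by apply: measurableT_comp; [exact: measurable_expR|exact: measurable_funM].
Qed.

Lemma L2w_reweight rho a f : L2w ip rho f -> L2w ip (rho + a) (reweight a f).
Proof.
move=> /L2wP[mf fi]; apply/L2wP; split.
  by apply: smeas_rscale => //; exact: measurable_expRM.
apply: eq_integrable fi => // t _ /=; congr EFin.
by rewrite /reweight ripZl // ripZr // -(weight_reweight rho a t); ring.
Qed.

Lemma wip_reweight rho a f g :
  wip (rho + a) (reweight a f) (reweight a g) = wip rho f g.
Proof.
apply: eq_Rintegral => t _.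
by rewrite /reweight ripZl // ripZr // -(weight_reweight rho a t); ring.
Qed.

Lemma wnorm_reweight rho a f :
  wnorm ip (rho + a) (reweight a f) = wnorm ip rho f.
Proof. by rewrite !wnormE wip_reweight. Qed.

Lemma L2w_reweightN rho f :
  L2w ip (- rho) f -> L2w ip rho (reweight (2 * rho) f).
Proof. by move=> /(@L2w_reweight _ (2 * rho)); rewrite mulr_natl addKr. Qed.

Lemma wnorm_reweightN rho f :
  wnorm ip rho (reweight (2 * rho) f) = wnorm ip (- rho) f.
Proof. by rewrite -(wnorm_reweight (- rho) (2 * rho)) mulr_natl addKr. Qed.

(** The factor exp (2 rho t) put on [g] cancels the weight. The unweighted pairing of weights [rho]
    and [- rho] thus inherits bilinearity and Cauchy-Schwarz from [wip]. *)
Lemma sre_pairing rho f g :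
  sre (pairing ip f g) = wip rho f (reweight (2 * rho) g).
Proof.
transitivity (\int[mu]_t rip ip (f t) (g t)).
  exact: sre_kint.
apply: eq_Rintegral => t _.
by rewrite ripZr // mulrAC -expRD subrr expR0 mul1r.
Qed.

End WeightedL2.

(** * Smooth bumps on an interval *)

Section Bump.
Context (R : realType).
Implicit Types (c x y : R) (P : {poly R}) (f g : R -> R).

(** Induction on the degree: half of the exponent absorbs [P], the other half absorbs the new factor
    y, because y <= (c/2)^-1 exp (c y / 2). *)
Lemma poly_expR_bound P c : 0 < c ->
  exists2 M, 0 <= M & forall y, 0 <= y -> `|P.[y]| <= M * expR (c * y).
Proof.
elim/poly_ind: P c => [|P k IH] c c0.
  by exists 0 => // y _; rewrite horner0 normr0 mul0r.
have c2 : 0 < c / 2 by rewrite divr_gt0.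
have [M M0 hM] := IH _ c2.
exists (M * (c / 2)^-1 + `|k|) => [|y y0].
  by rewrite addr_ge0 // mulr_ge0 // invr_ge0 ltW.
rewrite hornerMXaddC mulrDl; apply: le_trans (ler_normD _ _) _; apply: lerD.
  rewrite normrM (ger0_norm y0).
  have -> : expR (c * y) = expR (c / 2 * y) * expR (c / 2 * y).
    by rewrite -expRD; congr expR; field.
  have yb : y <= (c / 2)^-1 * expR (c / 2 * y).
    by rewrite ler_pdivlMl // (le_trans _ (expR_ge1Dx _)) // lerDr.
  by apply: le_trans (ler_pM _ y0 (hM y y0) yb) _ => //; rewrite mulrACA.
by rewrite ler_peMr // -expR0 ler_expR mulr_ge0 // ltW.
Qed.

(* All derivatives of [exp (- c / x)] at [x > 0] have this shape, and extend by
   [0] to the left of the origin. *)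
Definition flat c P (x : R) : R :=
  if 0 < x then P.[x^-1] * expR (- (c * x^-1)) else 0.

Lemma is_derive_flat c P x : 0 < c ->
  is_derive x 1 (flat c P) (flat c ('X^2 * (c *: P - P^`())) x).
Proof.
move=> c0; rewrite {2}/flat; case: ltgtP => [x0|x0|<-].
- apply: (@near_eq_is_derive _ _ _
      (fun z : R => horner P (z^-1) * expR (- (c * z^-1)))).
    near=> z; rewrite /flat ifT //; near: z.
    exact: lt_nbhsr.
  have xn0 : id x != 0 by rewrite gt_eqF.
  have dV := is_deriveV xn0 (is_derive_id x (1 : R)).
  have dP := is_derive1_comp (is_derive_poly P x^-1) dV.
  have dE := @is_derive1_comp _ expR (fun z => - (c * z^-1)) x _ _
    (is_derive_expR _) (is_deriveN (is_deriveZ c dV)).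
  apply: is_derive_eq (is_deriveM dP dE) _.
  rewrite /= !hornerE /GRing.scale /= exprVn; ring.
- apply: (@near_eq_is_derive _ _ _ (cst 0)).
  near=> z; rewrite /flat ifF //; apply/negbTE; rewrite -leNgt ltW //.
  by near: z; exact: lt_nbhsl.
- have [M M0 hM] := poly_expR_bound ('X^2 * P) c0.
  have : h^-1 *: ((flat c P \o shift 0) (h *: (1 : R)) - flat c P 0)
      @[h --> (0 : R)^'] --> (0 : R).
    apply/cvgrPdist_lt => e e0.
    have eM : 0 < e / (M + 1) by rewrite divr_gt0 // ltr_wpDl.
    near=> h.
    rewrite sub0r normrN /= /flat ltxx subr0 addr0 /GRing.scale /= mulr1.
    case: ifP => [h0|_]; last by rewrite mulr0 normr0.
    rewrite normrM gtr0_norm ?invr_gt0 //.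
    (* Two powers of 1/h move into the polynomial, which leaves a factor h in front of a quantity
       bounded by [M]; [M + 1] in the tolerance avoids division by zero. *)
    have -> : h^-1 * `|P.[h^-1] * expR (- (c * h^-1))| =
        h * (`|('X^2 * P).[h^-1]| * expR (- (c * h^-1))).
      rewrite hornerM hornerXn 2!normrM (gtr0_norm (expR_gt0 _)).
      rewrite [`|_ ^+ 2|]ger0_norm ?sqr_ge0 //.
      by field; rewrite gt_eqF.
    apply: (@le_lt_trans _ _ (h * M)).
      rewrite ler_pM2l // expRN -ler_pdivlMr ?invr_gt0 ?expR_gt0 // invrK.
      by rewrite hM // invr_ge0 ltW.
    have hlt : h < e / (M + 1).
      apply: le_lt_trans (ler_norm h) _; near: h.
      apply: dnbhs0_lt; exact: eM.
    move: hlt; rewrite ltr_pdivlMr ?ltr_wpDl // => hlt.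
    by apply: le_lt_trans hlt; rewrite ler_pM2l // lerDl.
  move=> h; apply: DeriveDef; first by apply/cvg_ex; eexists; exact: h.
  exact/cvg_lim.
Unshelve. all: by end_near. Qed.

(** A class containing the bump and closed under differentiation: smoothness of every order follows
    without a formula for the n-th derivative. *)
Inductive bump_algebra (c p q : R) : (R -> R) -> Prop :=
| bump_left P : bump_algebra c p q (fun t => flat c P (t - p))
| bump_right P : bump_algebra c p q (fun t => flat c P (q - t))
| bumpD f g : bump_algebra c p q f -> bump_algebra c p q g ->
    bump_algebra c p q (f + g)
| bumpM f g : bump_algebra c p q f -> bump_algebra c p q g ->
    bump_algebra c p q (f * g).

Lemma flatN c P x : flat c (- P) x = - flat c P x.
Proof. by rewrite /flat; case: ifP; rewrite ?oppr0 // hornerN mulNr. Qed.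

Lemma bump_algebra_derive c p q f : 0 < c -> bump_algebra c p q f ->
  exists2 g, bump_algebra c p q g & forall t : R, is_derive t (1 : R) f (g t).
Proof.
move=> c0; elim=> [P|P|{}f g Bf [f' Bf' df] Bg [g' Bg' dg]
  |{}f g Bf [f' Bf' df] Bg [g' Bg' dg]].
- eexists; first exact: (bump_left c p q ('X^2 * (c *: P - P^`()))).
  move=> t; have dt : is_derive t 1 (fun z : R => z - p) 1.
    exact: (is_derive_shift t 1 (- p)).
  have := @is_derive1_comp _ _ _ t _ _ (is_derive_flat P (t - p) c0) dt.
  by rewrite mulr1.
- eexists; first exact: (bump_right c p q (- ('X^2 * (c *: P - P^`())))).
  move=> t; have dt : is_derive t 1 (fun z : R => q - z) (- 1).
    have := is_deriveB (is_derive_cst q t 1) (is_derive_id t (1 : R)).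
    by rewrite sub0r.
  have := @is_derive1_comp _ _ _ t _ _ (is_derive_flat P (q - t) c0) dt.
  by rewrite mulrN1 -flatN.
- exists (f' + g') => [|t]; first exact: bumpD.
  exact: is_deriveD.
- exists (f * g' + g * f') => [|t]; first by apply: bumpD; exact: bumpM.
  exact: is_deriveM.
Qed.

Definition bump c p q : R -> R :=
  fun t => flat c 1%:P (t - p) * flat c 1%:P (q - t).

Lemma bump_smooth c p q : 0 < c -> exists Dv : nat -> R -> R,
  Dv 0%N = bump c p q /\
  forall n (t : R), is_derive t (1 : R) (Dv n) (Dv n.+1 t).
Proof.
move=> c0.
(* Bundling the membership proof lets [choice] return a derivation from [T] to itself, which can be
   iterated. *)
pose T := {f | bump_algebra c p q f}.
have /choice [D hD] : forall f : T, exists g : T,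
    forall t : R, is_derive t (1 : R) (sval f) (sval g t).
  move=> [f Bf]; have [g Bg dg] := bump_algebra_derive c0 Bf.
  by exists (exist _ g Bg).
have B0 : bump_algebra c p q (bump c p q).
  exact: (bumpM (bump_left c p q 1%:P) (bump_right c p q 1%:P)).
by exists (fun n => sval (iter n D (exist _ _ B0))); split.
Qed.

Lemma bump_out c p q t : ~~ (p < t < q) -> bump c p q t = 0.
Proof.
rewrite /bump /flat !subr_gt0 negb_and => /orP[] /negbTE ->.
  by rewrite mul0r.
by rewrite mulr0.
Qed.

Lemma bump_in c p q t : p < t < q ->
  bump c p q t = expR (- (c * ((t - p)^-1 + (q - t)^-1))).
Proof.
move=> /andP[pt tq]; rewrite /bump /flat !subr_gt0 pt tq !hornerC !mul1r -expRD.
by congr expR; ring.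
Qed.

Lemma bump01 c p q t : 0 < c -> 0 <= bump c p q t <= 1.
Proof.
move=> c0; have [h|h] := boolP (p < t < q); last first.
  by rewrite bump_out // lexx ler01.
rewrite bump_in // expR_ge0 /= -[leRHS]expR0 ler_expR oppr_le0.
case/andP: h => pt tq.
by rewrite mulr_ge0 ?addr_ge0 ?invr_ge0 ?subr_ge0 // ltW.
Qed.

Lemma bump_cvg p q t :
  bump n.+1%:R^-1 p q t @[n --> \oo] --> (\1_(`]p, q[%classic : set R) t : R).
Proof.
have [h|h] := boolP (p < t < q).
  rewrite indicE mem_set; last by rewrite /= in_itv.
  under eq_fun do rewrite bump_in //.
  rewrite -[1%:R]expR0; apply: continuous_cvg; first exact: continuous_expR.
  rewrite -oppr0; apply: cvgN.
  rewrite -[X in _ --> X](mul0r ((t - p)^-1 + (q - t)^-1)).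
  apply: cvgMl; exact: cvg_harmonic.
rewrite indicE memNset; last by rewrite /= in_itv /=; exact/negP.
by under eq_fun do rewrite bump_out //; exact: cvg_cst.
Qed.

End Bump.

(** * Compactly supported real functions *)

Section CompactSupport.
Context (R : realType).
Local Notation mu := (@lebesgue_measure R).
Implicit Types (F phi : R -> R) (M C : R).

Lemma integrable_compact_support F M : measurable_fun setT F ->
  (exists C, forall t, `|F t| <= C) -> (forall t, M < `|t| -> F t = 0) ->
  mu.-integrable setT (EFin \o F).
Proof.
move=> mF [C FC] F0.
have ic : mu.-integrable setT ((EFin \o cst C) \_ `[- M, M]).
  have : mu.-integrable `[- M, M] (EFin \o (cst C : R -> R)).
    apply: continuous_compact_integrable; first exact: segment_compact.
    by apply: continuous_subspaceT => x; exact: cvg_cst.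
  by move/integrable_mkcond; apply.
apply: le_integrable ic => //; first exact/measurable_EFinP.
move=> t _ /=; rewrite patchE; case: ifPn => [_|].
  by rewrite /= lee_fin (le_trans (FC t)) // ler_norm.
rewrite notin_setE /= in_itv /= => /negP; rewrite -ler_norml -ltNge => /F0 ->.
by rewrite normr0 lee_fin.
Qed.

Lemma continuous_bounded_compact_support phi M : continuous phi ->
  (forall t, M < `|t| -> phi t = 0) -> exists C, forall t, `|phi t| <= C.
Proof.
(* [M] may be negative; its absolute value keeps the interval nonempty for the extreme value
   theorem. *)
move=> cphi phi0; have M1 : - `|M| <= `|M|.
  by apply: (@le_trans _ _ 0); rewrite ?oppr_le0.
have cn : {within `[- `|M|, `|M|], continuous (fun t => `|phi t|)}.
  by apply: continuous_subspaceT => t; apply: cvg_norm; exact: cphi.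
have [c _ hc] := EVT_max M1 cn.
exists `|phi c| => t; have [tM|tM] := leP `|t| `|M|.
  by apply: hc; rewrite in_itv /= -ler_norml.
by rewrite phi0 ?normr0 // (le_lt_trans _ tM) // ler_norm.
Qed.

End CompactSupport.

(** * Smooth compactly supported functions with values in H *)

Section Density.
Context (R : realType) (b : bool) (H : lmodType (scal R b)).
Context (ip : H -> H -> scal R b) (hH : is_hilbert ip).
Local Notation hn := (hnorm ip).
Local Notation mu := (@lebesgue_measure R).
Implicit Types (f g : R -> H) (rho a r : R) (phi : R -> R) (h : H).

Lemma L2w_compact_support rho phi h M : measurable_fun setT phi ->
  (exists C, forall t, `|phi t| <= C) -> (forall t, M < `|t| -> phi t = 0) ->
  L2w ip rho (fun t => rscale (phi t) h).
Proof.
move=> mphi [C phiC] phi0; apply/L2wP => //; split.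
  by apply: smeas_rscale => //; exact: smeas_cst.
apply: (@integrable_compact_support _ _ M).
- apply: measurable_wip => //; apply: smeas_rscale => //; exact: smeas_cst.
(* The last factor bounds the weight on [-|M|, |M|]; outside, [phi] vanishes. *)
- exists (C * (C * rip ip h h) * expR (2 * `|rho| * `|M|)) => t.
  have [tM|tM] := leP `|t| `|M|; last first.
    rewrite phi0 ?(le_lt_trans (ler_norm M)) // ripZl // mul0r mul0r normr0.
    have C0 : 0 <= C by rewrite (le_trans _ (phiC t)).
    by rewrite !mulr_ge0 ?rip_ge0 ?expR_ge0.
  have C0 : 0 <= C by rewrite (le_trans _ (phiC t)).
  rewrite ripZl // ripZr // normrM ler_pM //.
    rewrite normrM ler_pM // normrM ler_pM //.
    by rewrite ger0_norm // rip_ge0.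
  rewrite gtr0_norm ?weight_gt0 // ler_expR.
  apply: le_trans (ler_norm _) _.
  by rewrite normrN !normrM ger0_norm // ler_pM // mulr_ge0.
- by move=> t /phi0 ->; rewrite ripZl // !mul0r.
Qed.

Lemma hderiv_rscale phi t d h : is_derive t (1 : R) phi d ->
  hderiv ip (fun s => rscale (phi s) h) t (rscale d h).
Proof.
move=> [dphi dE].
have cd : k^-1 * (phi (t + k) - phi t) @[k --> (0 : R)^'] --> d.
  rewrite -dE [X in X @ _ --> _](_ : _ =
    fun k => k^-1 *: ((phi \o shift t) (k *: (1 : R)) - phi t)) //.
  by apply/funext => k; rewrite /= /GRing.scale /= mulr1 (addrC t).
rewrite /hderiv.
have E k : hn ((sofR b k)^-1 *: (rscale (phi (t + k)) h - rscale (phi t) h)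
     - rscale d h) = `|k^-1 * (phi (t + k) - phi t) - d| * hn h.
  rewrite -hnormZ //; congr hn.
  rewrite /rscale -sofRV -scalerBl scalerA -scalerBl.
  by rewrite sofRD !sofRM !sofRN sofRD sofRN.
under eq_fun do rewrite E.
suff : `|k^-1 * (phi (t + k) - phi t) - d| * hn h @[k --> (0 : R)^'] -->
  `|d - d| * hn h by rewrite subrr normr0 mul0r.
by apply: cvgMl; apply: cvg_norm; apply: cvgB => //; exact: cvg_cst.
Qed.

Lemma hderivD f g t u v : hderiv ip f t u -> hderiv ip g t v ->
  hderiv ip (fun s => f s + g s) t (u + v).
Proof.
move=> fu gv.
apply: (@squeeze_cvgr _ _ _ _ (fun=> 0)
  (fun k => hn ((sofR b k)^-1 *: (f (t + k) - f t) - u)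
            + hn ((sofR b k)^-1 *: (g (t + k) - g t) - v))); last 2 first.
- exact: cvg_cst.
- by have cD := cvgD fu gv; rewrite addr0 in cD; exact: cD.
apply: nearW => k /=; rewrite hnorm_ge0 /=.
apply: le_trans (hnormD hH _ _).
by rewrite addrACA -opprD -scalerDr addrACA -opprD.
Qed.

Lemma hderivZ r f t u : hderiv ip f t u ->
  hderiv ip (fun s => rscale r (f s)) t (rscale r u).
Proof.
move=> fu; rewrite /hderiv.
have E k : hn ((sofR b k)^-1 *: (rscale r (f (t + k)) - rscale r (f t))
     - rscale r u) =
    `|r| * hn ((sofR b k)^-1 *: (f (t + k) - f t) - u).
  rewrite -hnormZ // /rscale !scalerBr !scalerA.
  by rewrite (mulrC (sofR b r)).
under eq_fun do rewrite E.
by have cM := @cvgMr _ _ _ _ _ `|r| _ fu; rewrite mulr0 in cM; exact: cM.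
Qed.

(** Membership in every weighted space is carried along, so strong measurability need not be
    recovered from [Cc], and one class serves for arguments (weight [rho]) and test functions
    (weight [- rho]). *)
Definition smooth_L2w f := Cc ip f /\ forall rho, L2w ip rho f.

Lemma smooth_L2wD f g :
  smooth_L2w f -> smooth_L2w g -> smooth_L2w (fun t => f t + g t).
Proof.
move=> [[[Df [Df0 dDf]] [M fM]] lf] [[[Dg [Dg0 dDg]] [N gN]] lg].
split=> [|rho]; last exact: L2wD.
split.
  exists (fun n t => Df n t + Dg n t); split => [|n t].
    by rewrite Df0 Dg0.
  exact: hderivD.
exists (Num.max M N) => t; rewrite gt_max => /andP[/fM -> /gN ->].
by rewrite addr0.
Qed.

Lemma smooth_L2wZ r f : smooth_L2w f -> smooth_L2w (fun t => rscale r (f t)).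
Proof.
move=> [[[Df [Df0 dDf]] [M fM]] lf].
split=> [|rho]; last exact: L2wZ.
split.
  exists (fun n t => rscale r (Df n t)); split => [|n t]; first by rewrite Df0.
  exact: hderivZ.
by exists M => t /fM ->; rewrite /rscale scaler0.
Qed.

Lemma smooth_L2w_bump c p q h : 0 < c ->
  smooth_L2w (fun t => rscale (bump c p q t) h).
Proof.
move=> c0; have [Dv [Dv0 dDv]] := bump_smooth p q c0.
have b0 t : Num.max `|p| `|q| < `|t| -> bump c p q t = 0.
  rewrite gt_max => /andP[pt qt]; rewrite bump_out //; apply/negP.
  move: pt qt; have := ler_norm q; have := ler_norm (- p); rewrite normrN.
  by case: (ger0P t) => t0 ? ? ? ? /andP[? ?]; lra.
split=> [|rho]; first split.
- exists (fun n t => rscale (Dv n t) h); split => [|n t]; first by rewrite Dv0.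
  exact: hderiv_rscale.
- by exists (Num.max `|p| `|q|) => t /b0 ->; rewrite rscale0.
- apply: (@L2w_compact_support _ _ _ (Num.max `|p| `|q|)) => //.
    apply: continuous_measurable_fun => t.
    apply: differentiable_continuous; apply/derivable1_diffP.
    by rewrite -Dv0; have [] := dDv 0%N t.
  by exists 1 => t; have /andP[? ?] := bump01 p q t c0; rewrite ger0_norm.
Qed.

Lemma wnorm_dominated rho (fs : nat -> R -> H) f g (c : R) :
  (forall n, L2w ip rho (fs n)) -> L2w ip rho f -> L2w ip rho g ->
  (forall n t, hn (fs n t - f t) <= c * hn (g t)) ->
  (forall t, (fun n => hn (fs n t - f t)) @ \oo --> (0 : R)) ->
  wnorm ip rho (fun t => fs n t - f t) @[n --> \oo] --> (0 : R).
Proof.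
move=> lfs lf /(L2wP hH)[mg ig] le_g cv.
have lfsf n : L2w ip rho (fun t => fs n t - f t) by exact: L2wB.
have [] := @dominated_convergence _ _ R mu setT measurableT
  (fun n t => (rip ip (fs n t - f t) (fs n t - f t) * weight rho t)%:E)
  (cst 0%E) (fun t => ((c ^+ 2)%:E * (rip ip (g t) (g t) * weight rho t)%:E)%E).
- move=> n; apply/measurable_EFinP; apply: measurable_wip => //;
  exact: L2w_smeas (lfsf n).
- exact: measurable_cst.
- apply: aeW => t _; apply: cvg_EFin; first exact: nearW.
  rewrite /comp /=; under eq_fun do rewrite -hnorm_sqr //.
  suff : hn (fs n t - f t) ^+ 2 * weight rho t @[n --> \oo] -->
      (0 : R) ^+ 2 * weight rho t by rewrite expr0n /= mul0r.
  by apply: cvgMl; apply: cvgM.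
- exact: integrableZl.
- apply: aeW => t n _; rewrite /= lee_fin.
  rewrite ger0_norm ?mulr_ge0 ?rip_ge0 ?expR_ge0 //.
  rewrite mulrA ler_wpM2r ?expR_ge0 // -!hnorm_sqr // -exprMn.
  by rewrite ler_pXn2r ?nnegrE ?hnorm_ge0 // (le_trans _ (le_g n t)) ?hnorm_ge0.
move=> _ _; rewrite integral0 => /fine_cvgP[_ h].
rewrite -(@sqrtr0 R); under eq_fun do rewrite wnormE //.
apply: continuous_cvg; first exact: sqrt_continuous.
exact: h.
Qed.

End Density.

(** * Density in the weighted spaces *)

Section DensityTheorem.
Context (R : realType) (b : bool) (H : lmodType (scal R b)).
Context (ip : H -> H -> scal R b) (hH : is_hilbert ip).
Local Notation hn := (hnorm ip).
Implicit Types (f g : R -> H) (rho r : R) (h : H) (A : set R).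

Definition approx rho f := L2w ip rho f /\
  forall e : R, 0 < e -> exists2 u, smooth_L2w ip u &
    wnorm ip rho (fun t => f t - u t) < e.

Lemma smooth_L2w_approx rho f : smooth_L2w ip f -> approx rho f.
Proof.
move=> gf; split=> [|e e0]; first by case: gf.
exists f => //; apply: le_lt_trans e0.
rewrite wnormE // (_ : wip _ _ _ _ = 0) ?sqrtr0 //.
rewrite /wip /Rintegral integral0_eq // => t _.
by rewrite subrr -hnorm_sqr // hnorm0 // expr0n mul0r.
Qed.

Lemma approxD rho f g : approx rho f -> approx rho g ->
  approx rho (fun t => f t + g t).
Proof.
move=> [lf af] [lg ag]; split=> [|e e0]; first exact: L2wD.
have e2 : 0 < e / 2 by rewrite divr_gt0.
have [u gu fu] := af _ e2; have [v gv gv'] := ag _ e2.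
exists (fun t => u t + v t); first exact: smooth_L2wD.
have lu : L2w ip rho u by case: gu.
have lv : L2w ip rho v by case: gv.
rewrite (splitr e); apply: le_lt_trans (ltrD fu gv').
apply: le_trans (wnormD hH (L2wB hH lf lu) (L2wB hH lg lv)).
by under [in leRHS]eq_fun do rewrite addrACA -opprD.
Qed.

Lemma approxN rho f : approx rho f -> approx rho (fun t => - f t).
Proof.
move=> [lf af]; split=> [|e e0]; first exact: L2wN.
have [u gu fu] := af _ e0; exists (fun t => - u t).
  by have := smooth_L2wZ hH (-1) gu; under eq_fun do rewrite rscaleN1.
rewrite wnormB //; under eq_fun do rewrite opprK addrC.
by [].
Qed.

Lemma approx_lim rho (fs : nat -> R -> H) f : (forall n, approx rho (fs n)) ->
  L2w ip rho f ->
  wnorm ip rho (fun t => fs n t - f t) @[n --> \oo] --> (0 : R) ->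
  approx rho f.
Proof.
move=> afs lf cv; split=> // e e0.
have e2 : 0 < e / 2 by rewrite divr_gt0.
have /cvgrPdist_lt /(_ _ e2) [N _ /(_ N (leqnn N))] := cv.
rewrite /= sub0r normrN ger0_norm ?wnorm_ge0 // => fN.
have [lN /(_ _ e2) [u gu fu]] := afs N.
exists u => //; rewrite (splitr e); rewrite wnormB // in fN.
apply: le_lt_trans (ltrD fN fu); apply: wnorm_trans => //.
by case: gu.
Qed.

Lemma approx_dominated rho (fs : nat -> R -> H) f g (c : R) :
  (forall n, approx rho (fs n)) -> L2w ip rho f -> L2w ip rho g ->
  (forall n t, hn (fs n t - f t) <= c * hn (g t)) ->
  (forall t, (fun n => hn (fs n t - f t)) @ \oo --> (0 : R)) ->
  approx rho f.
Proof.
move=> afs lf lg le_g cv; apply: (approx_lim afs) => //.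
by apply: wnorm_dominated le_g cv => // n; have [] := afs n.
Qed.

Lemma approx_sum rho (I : eqType) (s : seq I) (F : I -> R -> H) :
  (forall i, i \in s -> approx rho (F i)) ->
  approx rho (fun t => \sum_(i <- s) F i t).
Proof.
elim: s => [|i s IH] aF.
  under eq_fun do rewrite big_nil.
  (* The zero function is taken as a bump times the vector [0]. *)
  have := smooth_L2w_approx rho (smooth_L2w_bump hH 0 0 0 ltr01).
  by under eq_fun do rewrite /rscale scaler0.
under eq_fun do rewrite big_cons.
apply: approxD; first by apply: aF; rewrite mem_head.
by apply: IH => j js; apply: aF; rewrite inE js orbT.
Qed.

Lemma cvg_rscale (u : nat -> R) r h : u @ \oo --> r ->
  (fun n => hn (rscale (u n) h - rscale r h)) @ \oo --> (0 : R).
Proof.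
move=> ur; under eq_fun do rewrite /rscale -scalerBl -sofRN -sofRD hnormZ //.
suff : `|u n - r| * hn h @[n --> \oo] --> `|r - r| * hn h.
  by rewrite subrr normr0 mul0r.
by apply: cvgMl; apply: cvg_norm; apply: cvgB => //; exact: cvg_cst.
Qed.

Lemma L2w_indic rho A (N : R) h : measurable A -> A `<=` `]- N, N[ ->
  L2w ip rho (fun t => rscale (\1_A t) h).
Proof.
move=> mA AN; apply: (@L2w_compact_support _ _ _ _ hH _ _ _ N).
- exact: measurable_indic.
- by exists 1 => t; rewrite indicE; case: (_ \in _); rewrite ?normr0 ?normr1.
- move=> t Nt; rewrite indicE memNset // => /AN /=.
  by rewrite in_itv /= -ltr_norml => /ltW; rewrite leNgt Nt.
Qed.

(** The bumps lie between 0 and the indicator, so the indicator itself dominates the error. *)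
Lemma approx_itv rho p q h : approx rho (fun t => rscale (\1_`]p, q[ t) h).
Proof.
have l : L2w ip rho (fun t => rscale (\1_`]p, q[ t) h).
  apply: (@L2w_indic _ _ (Num.max `|p| `|q|)) => // t /=.
  rewrite !in_itv /= => /andP[pt tq]; rewrite -ltr_norml lt_max.
  case: (ger0P t) => t0.
    by apply/orP; right; apply: lt_le_trans tq _; exact: ler_norm.
  apply/orP; left; rewrite -normrN; apply: lt_le_trans (ler_norm _).
  by rewrite ltrN2.
apply: (@approx_dominated _ (fun n t => rscale (bump n.+1%:R^-1 p q t) h)
  _ (fun t => rscale (\1_`]p, q[ t) h) 1) => //.
- move=> n; apply: smooth_L2w_approx; apply: (smooth_L2w_bump hH).
  by rewrite invr_gt0.
- move=> n t; rewrite mul1r /rscale -scalerBl -sofRN -sofRD !hnormZ //.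
  apply: ler_wpM2r; first exact: hnorm_ge0.
  rewrite indicE; have [ht|ht] := boolP (p < t < q).
    rewrite mem_set /= ?normr1; last by rewrite in_itv.
    have n0 : 0 < n.+1%:R^-1 :> R by rewrite invr_gt0.
    by have /andP[? ?] := bump01 p q t n0; rewrite ler_norml; lra.
  by rewrite bump_out // memNset ?subrr // /= in_itv /=; exact/negP.
- by move=> t; apply: cvg_rscale; exact: bump_cvg.
Qed.

(** Cutting with ]-N, N[ keeps every indicator in [L2w], which complements of bounded sets would
    violate. The generating pi-system is that of the rays ]x, +oo[, whose traces are open
    intervals. *)
Lemma approx_indic rho (N : R) h A : measurable A ->
  approx rho (fun t => rscale (\1_(A `&` `]- N, N[) t) h).
Proof.
move=> mA.
have EG : @measurable _ R = <<s @RGenOInfty.G R >>.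
  exact: RGenOInfty.measurableE.
rewrite EG in mA; move: A mA; apply: (dynkin_induction EG).
- move=> _ _ [x ->] [y ->]; exists (Num.max x y).
  apply/seteqP; split=> t /=; rewrite !in_itv /= !andbT gt_max.
    by case=> -> ->.
  by move=> /andP[].
- by rewrite setTI; exact: approx_itv.
- move=> _ [x ->].
  suff -> : `]x, +oo[%classic `&` `]- N, N[ = `]Num.max x (- N), N[%classic.
    exact: approx_itv.
  apply/seteqP; split=> t /=; rewrite !in_itv /= gt_max.
    by move=> [/andP[-> _] ->].
  by move=> /andP[/andP[-> ->] ->].
- move=> S mS aS.
  suff -> : (fun t => rscale (\1_(~` S `&` `]- N, N[) t) h) =
      (fun t => rscale (\1_`]- N, N[ t) h - rscale (\1_(S `&` `]- N, N[) t) h).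
    by apply: approxD; [exact: approx_itv|exact: approxN].
  apply/funext => t; rewrite /rscale -scalerBl -sofRN -sofRD !indicE !in_setI.
  rewrite in_setC; case: (t \in S); case: (t \in _);
  by rewrite /= ?subrr ?subr0.
- move=> F mF tF aF.
  have sumE n t : \sum_(0 <= k < n) rscale (\1_(F k `&` `]- N, N[) t) h =
      rscale (\sum_(0 <= k < n) \1_(F k `&` `]- N, N[) t) h.
    elim: n => [|n IH]; first by rewrite !big_geq // rscale0.
    by rewrite !big_nat_recr //= IH rscaleDl.
  (* By disjointness only the term [k0] contributes: the partial sums jump from 0 to 1 once [k0] is
     included. *)
  have sumF t k0 n : (F k0 `&` `]- N, N[) t ->
      \sum_(0 <= k < n) \1_(F k `&` `]- N, N[) t = (k0 < n)%:R :> R.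
    move=> [Ft It]; elim: n => [|n IH]; first by rewrite big_geq.
    rewrite big_nat_recr //= IH indicE in_setI (mem_set It) andbT ltnS.
    have [->|nk] := eqVneq n k0.
      by rewrite mem_set // ltnn leqnn add0r.
    rewrite memNset ?addr0; last first.
      by move=> Fn; move/eqP: nk; apply; apply: tF => //; exists t.
    by rewrite [in RHS]leq_eqVlt [k0 == n]eq_sym (negbTE nk).
  have sum0 t n : ~ (\bigcup_k F k `&` `]- N, N[) t ->
      \sum_(0 <= k < n) \1_(F k `&` `]- N, N[) t = 0 :> R.
    move=> nt; rewrite big1 // => k _; rewrite indicE memNset //.
    by move=> [Fk It]; apply: nt; split => //; exists k.
  apply: (@approx_dominated _ (fun n t => \sum_(0 <= k < n)
      rscale (\1_(F k `&` `]- N, N[) t) h) _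
    (fun t => rscale (\1_`]- N, N[ t) h) 1) => //.
  + by move=> n; apply: approx_sum => k _; exact: aF.
  + apply: (@L2w_indic _ _ N) => //; apply: measurableI => //.
    exact: bigcup_measurable.
  + exact: (@L2w_indic _ _ N).
  + move=> n t; rewrite mul1r sumE /rscale -scalerBl -sofRN -sofRD !hnormZ //.
    apply: ler_wpM2r; first exact: hnorm_ge0.
    have [[[k0 _ Fk] It]|nt] := pselect ((\bigcup_k F k `&` `]- N, N[) t).
      rewrite (@sumF _ k0) // !indicE !mem_set //; last first.
        by split => //; exists k0.
      by case: (_ < _)%N; rewrite ?subrr ?sub0r ?normrN normr1 ?normr0.
    by rewrite sum0 // [\1_(_ `&` _) t]indicE memNset // subrr normr0.
  + move=> t; under eq_fun do rewrite sumE; apply: cvg_rscale.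
    have [[[k0 _ Fk] It]|nt] := pselect ((\bigcup_k F k `&` `]- N, N[) t).
      rewrite indicE mem_set; last by split => //; exists k0.
      apply: cvg_near_cst; exists k0.+1 => // n /= kn.
      by rewrite (@sumF _ k0) // kn.
    rewrite indicE memNset //.
    by under eq_fun do rewrite sum0 //; exact: cvg_cst.
Qed.

Lemma approx_simple rho (N : R) (s : R -> H) : simple s ->
  (forall t, N <= `|t| -> s t = 0) -> approx rho s.
Proof.
move=> [fs ms] sN; pose X : seq H := finmap.enum_fset (fset_set (range s)).
have -> : s = fun t => \sum_(h <- X)
    rscale (\1_((s @^-1` [set h]) `&` `]- N, N[) t) h.
  apply/funext => t.
  have st : s t \in X.
    by rewrite in_fset_set // mem_set //; exists t.
  rewrite (bigD1_seq (s t)) ?finmap.fset_uniq //= big1 => [|h hs]; last first.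
    rewrite indicE memNset ?rscale0 // => -[/= sth _].
    by rewrite sth eqxx in hs.
  rewrite addr0 indicE; have [tN|/sN ->] := ltP `|t| N.
    by rewrite mem_set ?rscale1 //; split => //=; rewrite in_itv /= -ltr_norml.
  by rewrite /rscale scaler0.
by apply: approx_sum => h _; exact: approx_indic.
Qed.

(** The simple functions given by measurability converge pointwise without domination. Setting them
    to 0 where |s n| > 2 |f| or |t| >= n forces |s' n - f| <= 3 |f| and bounded support. *)
Theorem L2w_approx rho f : L2w ip rho f -> approx rho f.
Proof.
move=> lf; have [s [ss cs]] := L2w_smeas lf.
pose test n t := (hn (s n t) <= 2 * hn (f t)) && (`|t| < n%:R).
pose s' n t := if test n t then s n t else 0.
have mtest n : simple (test n).
  have mt : measurable_fun setT (test n).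
    apply: measurable_and.
      apply: measurable_fun_ler.
        exact: simple_measurable_fun (simple_op1 hn (ss n)).
      apply: measurable_funM; first exact: measurable_cst.
      exact: measurable_hnorm (L2w_smeas lf).
    apply: measurable_fun_ltr; last exact: measurable_cst.
    exact: normr_measurable.
  split=> [|y]; first exact: finite_finset.
  by rewrite -[X in measurable X]setTI; apply: mt.
have ss' n : simple (s' n).
  exact: (simple_op2 (fun (y : bool) (h : H) => if y then h else 0)
    (mtest n) (ss n)).
have as' n : approx rho (s' n).
  apply: (@approx_simple _ n%:R) => // t nt.
  by rewrite /s' /test ltNge nt andbF.
apply: (@approx_dominated _ s' _ f 3) => //.
- move=> n t; rewrite /s' /test; case: ifPn => [/andP[h _]|_].
    by have := hnormD hH (s n t) (- f t); rewrite hnormN //; lra.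
  by rewrite sub0r hnormN //; have := hnorm_ge0 ip (f t); lra.
(* Where f vanishes, the cut-off makes [s' n] vanish too. Elsewhere |s n - f| < |f| eventually,
   hence |s n| <= 2 |f| and the cut-off is inactive. *)
- move=> t; have [ft0|ft0] := eqVneq (hn (f t)) 0.
    have E n : hn (s' n t - f t) = 0.
      rewrite (hnorm_eq0 hH ft0) subr0 /s' /test ft0 mulr0.
      case: ifPn => [/andP[h _]|_]; last exact: hnorm0.
      by apply/eqP; rewrite eq_le h hnorm_ge0.
    by under eq_fun do rewrite E; exact: cvg_cst.
  have fp : 0 < hn (f t) by rewrite lt_neqAle eq_sym ft0 hnorm_ge0.
  apply: cvg_trans (cs t); apply: near_eq_cvg; near=> n.
  rewrite /s' /test ifT //; apply/andP; split.
    have : hn (s n t - f t) < hn (f t).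
      by near: n; exact: (cvgr_lt 0 (cs t)).
    have := hnormD hH (s n t - f t) (f t); rewrite subrK; lra.
  by near: n; exact: nbhs_infty_gtr.
Unshelve. all: by end_near. Qed.

End DensityTheorem.

(** * Integration by parts on the line *)

Section RealCalculus.
Context (R : realType).
Local Notation mu := (@lebesgue_measure R).
Implicit Types (phi : R -> R) (M : R).

Lemma derivable_continuous phi :
  (forall t, derivable phi t 1) -> continuous phi.
Proof.
move=> dphi t; apply: differentiable_continuous.
exact/derivable1_diffP.
Qed.

Lemma derive1_out phi M : (forall t, M < `|t| -> phi t = 0) ->
  forall t, M < `|t| -> derive1 phi t = 0.
Proof.
move=> phi0 t Mt; rewrite derive1E.
rewrite (@near_eq_derive _ _ _ phi (cst 0)) ?derive_cst //.
near=> s; apply: phi0; near: s.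
have : continuous (fun s : R => `|s|) by exact: norm_continuous.
by move=> /(_ t) /cvgr_gt; apply.
Unshelve. all: by end_near. Qed.

Lemma integration_by_parts_compact (phi psi : R -> R) M :
  (forall t, derivable phi t 1) -> continuous (derive1 phi) ->
  (forall t, derivable psi t 1) -> continuous (derive1 psi) ->
  (forall t, M < `|t| -> psi t = 0) ->
  \int[mu]_t (phi t * derive1 psi t) = - \int[mu]_t (derive1 phi t * psi t).
Proof.
move=> dphi cphi' dpsi cpsi' psi0.
have cphi := derivable_continuous dphi.
have cpsi := derivable_continuous dpsi.
have c1 : continuous (fun t => phi t * derive1 psi t).
  by move=> t; apply: cvgM; [exact: cphi|exact: cpsi'].
have c2 : continuous (fun t => derive1 phi t * psi t).
  by move=> t; apply: cvgM; [exact: cphi'|exact: cpsi].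
have z1 t : M < `|t| -> phi t * derive1 psi t = 0.
  by move=> Mt; rewrite (derive1_out psi0) // mulr0.
have z2 t : M < `|t| -> derive1 phi t * psi t = 0.
  by move=> Mt; rewrite psi0 // mulr0.
have i1 : mu.-integrable setT (EFin \o (fun t => phi t * derive1 psi t)).
  apply: (@integrable_compact_support _ _ M) => //.
    exact: continuous_measurable_fun.
  exact: continuous_bounded_compact_support c1 z1.
have i2 : mu.-integrable setT (EFin \o (fun t => derive1 phi t * psi t)).
  apply: (@integrable_compact_support _ _ M) => //.
    exact: continuous_measurable_fun.
  exact: continuous_bounded_compact_support c2 z2.
apply/eqP; rewrite -addr_eq0 -RintegralD //; apply/eqP.
(* [N] strictly exceeds [M], so [psi] vanishes at both endpoints, and it is positive, so the
   interval is nondegenerate. *)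
pose N := `|M| + 1.
have N0 : 0 < N by rewrite ltr_wpDl.
have MN : M < N by rewrite (le_lt_trans (ler_norm M)) // ltrDl.
pose F' t := phi t * derive1 psi t + derive1 phi t * psi t.
have -> : \int[mu]_t F' t = \int[mu]_(t in `[- N, N]) F' t.
  rewrite [RHS]Rintegral_mkcond; apply: eq_Rintegral => t _.
  rewrite patchE; case: ifPn => //.
  rewrite notin_setE /= in_itv /= => /negP; rewrite -ler_norml -ltNge => Nt.
  have Mt := lt_trans MN Nt.
  by rewrite /F' z1 // z2 // addr0.
have dF (t : R) : is_derive t (1 : R) (fun s => phi s * psi s) (F' t).
  have := is_deriveM (derivableP (dphi t)) (derivableP (dpsi t)).
  by rewrite -!derive1E /GRing.scale /= [psi t * _]mulrC.
rewrite /Rintegral (@continuous_FTC2 _ F' (fun s => phi s * psi s)).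
- rewrite !psi0 ?mulr0 ?subee // ?normrN ger0_norm // ?ltW //.
- by rewrite gtrN.
- by apply: continuous_subspaceT => t; apply: cvgD; [exact: c1|exact: c2].
- have cF : continuous (fun s => phi s * psi s).
    by move=> t; apply: cvgM; [exact: cphi|exact: cpsi].
  split=> [t _||]; first by have [] := dF t.
    exact/cvg_at_right_filter/cF.
  exact/cvg_at_left_filter/cF.
- by move=> t _; rewrite derive1E; have [] := dF t.
Qed.

End RealCalculus.

(** * Duality between opposite weights *)

Section Pairing.
Context (R : realType) (b : bool) (H : lmodType (scal R b)).
Context (ip : H -> H -> scal R b) (hH : is_hilbert ip).
Local Notation hn := (hnorm ip).
Local Notation mu := (@lebesgue_measure R).
Implicit Types (f g psi : R -> H) (rho r : R) (phi : R -> R) (h : H).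

Definition rpair f g : R := sre (pairing ip f g).

Lemma rpairE f g : rpair f g = \int[mu]_t rip ip (f t) (g t).
Proof. exact: sre_kint. Qed.

Lemma rpairDl rho f f' g : L2w ip rho f -> L2w ip rho f' -> L2w ip (- rho) g ->
  rpair (fun t => f t + f' t) g = rpair f g + rpair f' g.
Proof.
move=> lf lf' lg; rewrite /rpair !(sre_pairing hH rho).
exact: wipDl (L2w_reweightN hH lg).
Qed.

Lemma rpairZl rho r f g : L2w ip rho f -> L2w ip (- rho) g ->
  rpair (fun t => rscale r (f t)) g = r * rpair f g.
Proof.
move=> lf lg; rewrite /rpair !(sre_pairing hH rho).
exact: wipZl (L2w_reweightN hH lg).
Qed.

Lemma rpairNl rho f g : L2w ip rho f -> L2w ip (- rho) g ->
  rpair (fun t => - f t) g = - rpair f g.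
Proof.
move=> lf lg; rewrite -mulN1r -(rpairZl _ lf lg).
by under [in RHS]eq_fun do rewrite rscaleN1.
Qed.

Lemma rpairBl rho f f' g : L2w ip rho f -> L2w ip rho f' -> L2w ip (- rho) g ->
  rpair (fun t => f t - f' t) g = rpair f g - rpair f' g.
Proof.
move=> lf lf' lg.
by rewrite (rpairDl lf (L2wN hH lf') lg) (rpairNl lf' lg).
Qed.

Lemma rpairC f g : rpair f g = rpair g f.
Proof. by rewrite !rpairE; apply: eq_Rintegral => t _; rewrite ripC. Qed.

Lemma rpairDr rho f g g' : L2w ip rho f -> L2w ip (- rho) g ->
  L2w ip (- rho) g' -> rpair f (fun t => g t + g' t) = rpair f g + rpair f g'.
Proof.
move=> lf lg lg'.
by rewrite rpairC (@rpairDl (- rho)) ?opprK // !(rpairC f).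
Qed.

Lemma rpairZr rho r f g : L2w ip rho f -> L2w ip (- rho) g ->
  rpair f (fun t => rscale r (g t)) = r * rpair f g.
Proof.
by move=> lf lg; rewrite rpairC (@rpairZl (- rho)) ?opprK // rpairC.
Qed.

Lemma rpair_CS rho f g : L2w ip rho f -> L2w ip (- rho) g ->
  `|rpair f g| <= wnorm ip rho f * wnorm ip (- rho) g.
Proof.
move=> lf lg; rewrite /rpair (sre_pairing hH rho) -(wnorm_reweightN hH rho g).
exact: wip_CS (L2w_reweightN hH lg).
Qed.

(** Multiplication by exp (- 2 rho t) is the Riesz isometry from weight [rho] onto weight [- rho]
    for the unweighted pairing. *)
Lemma L2w_dual rho f :
  L2w ip rho f -> L2w ip (- rho) (reweight (- (2 * rho)) f).
Proof.
move=> /(L2w_reweight hH (- (2 * rho))).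
by rewrite (_ : rho + - (2 * rho) = - rho) //; ring.
Qed.

Lemma rpair_dual rho f g : rpair f (reweight (- (2 * rho)) g) = wip ip rho f g.
Proof.
rewrite rpairE; apply: eq_Rintegral => t _.
by rewrite /reweight ripZr // mulrC mulNr.
Qed.

Lemma wnorm_dual rho f :
  wnorm ip (- rho) (reweight (- (2 * rho)) f) = wnorm ip rho f.
Proof.
rewrite -(wnorm_reweight hH rho (- (2 * rho))).
by rewrite (_ : rho + - (2 * rho) = - rho) //; ring.
Qed.

(** Pairing [f] with its Riesz representative [k] gives |f|^2; as [k] need not be smooth, it is
    replaced by a smooth function nearby. *)
Lemma wnorm_le_dual rho f M : L2w ip rho f -> 0 <= M ->
  (forall psi, smooth_L2w ip psi ->
     `|rpair f psi| <= M * wnorm ip (- rho) psi) ->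
  wnorm ip rho f <= M.
Proof.
move=> lf M0 hM; set k := reweight (- (2 * rho)) f.
have lk : L2w ip (- rho) k by exact: L2w_dual.
set X := wnorm ip rho f; have X0 : 0 <= X by exact: wnorm_ge0.
have XX : X ^+ 2 <= M * X.
  apply/ler_addgt0Pr => e e0.
  (* With d = |k - psi| one gets X^2 <= M |psi| + X d <= M X + (M + X) d, which dictates this
     tolerance. *)
  have d0 : 0 < e / (M + X + 1) by rewrite divr_gt0 // ltr_wpDl // addr_ge0.
  have [_ /(_ _ d0) [psi gpsi kpsi]] := L2w_approx hH lk.
  have lpsi : L2w ip (- rho) psi := gpsi.2 (- rho).
  have lkp := L2wB hH lk lpsi.
  have E : X ^+ 2 = rpair f psi + rpair f (fun t => k t - psi t).
    rewrite wnorm_sqr // -rpair_dual -(rpairDr lf) //.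
    by congr rpair; apply/funext => t; rewrite addrC subrK.
  have h1 := le_trans (ler_norm _) (hM _ gpsi).
  have h2 := le_trans (ler_norm _) (rpair_CS lf lkp).
  have h3 : wnorm ip (- rho) psi <= X + wnorm ip (- rho) (fun t => k t - psi t).
    rewrite -[X]wnorm_dual -/k (wnormB hH).
    have := wnormD hH lk (L2wB hH lpsi lk).
    by under eq_fun do rewrite addrC subrK.
  move: kpsi; rewrite ltr_pdivlMr ?ltr_wpDl ?addr_ge0 // => kpsi.
  rewrite E; have := wnorm_ge0 ip (- rho) (fun t => k t - psi t).
  move: h1 h2 h3 kpsi; rewrite -/X; nra.
have [->//|Xn] := eqVneq X 0.
have Xp : 0 < X by rewrite lt_neqAle eq_sym Xn.
by move: XX; rewrite expr2 ler_pM2r.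
Qed.

Lemma Cc_Cplus f : Cc ip f -> Cplus ip f.
Proof.
move=> [[Dv [D0 dD]] [M fM]]; exists Dv; split => //.
  by exists `|M| => t Mt; rewrite fM // (le_lt_trans (ler_norm M)) //
    (lt_le_trans Mt) // ler_norm.
by exists 0%N, M => t /fM; rewrite D0.
Qed.

Lemma cont_ext_lipschitz rho C (F : (R -> H) -> (R -> H) -> scal R b)
    (Fr : (R -> H) -> R -> H) : 0 <= C -> cont_ext ip rho F Fr ->
  (forall u w psi, Cc ip u -> Cc ip w -> Cplus ip psi ->
     kabs (F u psi - F w psi)
       <= C * wnorm ip (- rho) psi * wnorm ip rho (fun t => u t - w t)) ->
  forall x y, L2w ip rho x -> L2w ip rho y ->
    wnorm ip rho (fun t => Fr x t - Fr y t)
      <= C * wnorm ip rho (fun t => x t - y t).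
Proof.
move=> C0 [FrL Frc FrF] lip.
have lipg u w : smooth_L2w ip u -> smooth_L2w ip w ->
    wnorm ip rho (fun t => Fr u t - Fr w t)
      <= C * wnorm ip rho (fun t => u t - w t).
  move=> [Cu lu] [Cw lw].
  apply: wnorm_le_dual; first by apply: L2wB => //; exact: FrL.
    by rewrite mulr_ge0 // wnorm_ge0.
  move=> psi [Cpsi lpsi]; have Ppsi := Cc_Cplus Cpsi.
  rewrite (rpairBl (FrL _ (lu rho)) (FrL _ (lw rho)) (lpsi _)).
  rewrite /rpair -!FrF // -sreN -sreD mulrAC.
  exact: le_trans (sre_kabs _) (lip _ _ _ Cu Cw Ppsi).
move=> x y lx ly; apply/ler_addgt0Pr => e e0.
(* Replacing [x], [y] by smooth functions costs 2 d in the values and 2 d in the arguments, the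
   latter multiplied by [C]: in total exactly [e]. *)
pose d := e / (2 * C + 2).
have d0 : 0 < d by rewrite divr_gt0 // ltr_wpDl // mulr_ge0.
have dE : e = 2 * d + C * (2 * d).
  by rewrite /d; field; rewrite gt_eqF // ltr_wpDl // mulr_ge0.
have arith (xy fxy fux fuy fuw fwy uw xu0 xw yw0 : R) :
    fxy <= fux + fuy -> fuy <= fuw + fwy -> uw <= xu0 + xw -> xw <= xy + yw0 ->
    fuw <= C * uw -> fux < d -> fwy < d -> xu0 < d -> yw0 < d ->
    fxy <= C * xy + e.
  move=> *; have : C * uw <= C * (xy + 2 * d) by apply: ler_wpM2l => //; lra.
  rewrite dE; lra.
have [dx dx0 hx] := Frc _ lx _ d0; have [dy dy0 hy] := Frc _ ly _ d0.
(* The approximant has to be close enough both for continuity of [Fr] and for the distance of the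
   arguments. *)
have mx : 0 < Num.min dx d by rewrite lt_min dx0.
have my : 0 < Num.min dy d by rewrite lt_min dy0.
have [_ /(_ _ mx) [u gu]] := L2w_approx hH lx.
rewrite lt_min => /andP[xu xu'].
have [_ /(_ _ my) [w gw]] := L2w_approx hH ly.
rewrite lt_min => /andP[yw yw'].
have lu : L2w ip rho u := gu.2 rho.
have lw : L2w ip rho w := gw.2 rho.
have hxu : wnorm ip rho (fun t => Fr u t - Fr x t) < d.
  by apply: (hx u lu); rewrite (wnormB hH).
have hyw : wnorm ip rho (fun t => Fr w t - Fr y t) < d.
  by apply: (hy w lw); rewrite (wnormB hH).
have t1 := wnorm_trans hH (FrL _ lx) (FrL _ lu) (FrL _ ly).
have t2 := wnorm_trans hH (FrL _ lu) (FrL _ lw) (FrL _ ly).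
have t3 := wnorm_trans hH lu lx lw.
have t4 := wnorm_trans hH lx ly lw.
have t5 := lipg _ _ gu gw.
rewrite (wnormB hH _ u x) in t3; rewrite (wnormB hH _ (Fr x) (Fr u)) in t1.
exact: arith t1 t2 t3 t4 t5 hxu hyw xu' yw'.
Qed.

(** The vector [h] is arbitrary, so replacing it by [c *: h] turns the real identity into the one
    for imaginary parts. *)
Lemma weak_deriv_sre psi g :
  (forall h phi, test_fun phi ->
    \int[mu]_t (rip ip (psi t) h * derive1 phi t) =
    - \int[mu]_t (rip ip (g t) h * phi t)) -> weak_deriv ip psi g.
Proof.
move=> hyp h phi tphi; have [c simE] := @sim_sre R b.
apply: scal_ext; rewrite ?sreN ?simN ?sre_kint ?sim_kint.
  have := hyp h phi tphi; congr (_ = - _); apply: eq_Rintegral => t _;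
  by rewrite [in RHS]mulrC sreZ mulrC.
have := hyp (c *: h) phi tphi; congr (_ = - _); apply: eq_Rintegral => t _;
by rewrite /rip ipZr // -simE [in RHS]mulrC simZ mulrC.
Qed.

End Pairing.

(** * Energy estimate and norm of the jump *)

Section Energy.
Context (R : realType) (b : bool) (H : lmodType (scal R b)).
Context (ip : H -> H -> scal R b) (hH : is_hilbert ip).
Local Notation hn := (hnorm ip).
Local Notation mu := (@lebesgue_measure R).
Implicit Types (f g v psi : R -> H) (rho r : R) (phi : R -> R) (h : H).

(** One continuous derivative suffices: [chi] times a vector will only serve as an element of the
    domain of the derivative. *)
Lemma test_fun_weighted a phi : test_fun phi ->
  let chi t := expR (a * t) * phi t in
  [/\ forall t, derivable chi t 1,
      forall t, derive1 chi t = expR (a * t) * derive1 phi t + a * chi t,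
      continuous (derive1 chi) &
      exists M, forall t, M < `|t| -> chi t = 0].
Proof.
move=> [dphi [M phi0]] chi.
have dphi0 := dphi 0%N; have dphi1 := dphi 1%N; rewrite /= in dphi0 dphi1.
have dE (t : R) :
    is_derive t (1 : R) (fun s => expR (a * s)) (a * expR (a * t)).
  have dl := is_deriveZ a (is_derive_id t (1 : R)).
  have := @is_derive1_comp _ expR _ t _ _ (is_derive_expR _) dl.
  by rewrite /GRing.scale /= mulr1 [_ * a]mulrC.
have dchi (t : R) : is_derive t (1 : R) chi
    (expR (a * t) * derive1 phi t + a * chi t).
  have := is_deriveM (dE t) (derivableP (dphi0 t)).
  by rewrite -derive1E /GRing.scale /= /chi [phi t * _]mulrC mulrA.
have D1 t : derive1 chi t = expR (a * t) * derive1 phi t + a * chi t.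
  by rewrite derive1E; have [] := dchi t.
have cE : continuous (fun t : R => expR (a * t)).
  by apply: derivable_continuous => t; have [] := dE t.
have cchi : continuous chi.
  by apply: derivable_continuous => t; have [] := dchi t.
split.
- by move=> t; have [] := dchi t.
- exact: D1.
- rewrite (_ : derive1 chi = fun t => expR (a * t) * derive1 phi t + a * chi t).
    move=> t; apply: cvgD; last by apply: cvgM; [exact: cvg_cst|exact: cchi].
    apply: cvgM; first exact: cE.
    exact: derivable_continuous dphi1 t.
  exact/funext.
- by exists M => t Mt; rewrite /chi phi0 // mulr0.
Qed.

(* The weak equation [v' = f] can be tested with [exp (- 2 rho t) v] itself,
   whose weak derivative is [exp (- 2 rho t) (f - 2 rho v)]; this gives
   [rho |v|^2 = Re <v, f>]. *)
Lemma energy_estimate rho v f : 0 < rho -> L2w ip rho v -> L2w ip rho f ->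
  (forall psi g, L2w ip (- rho) psi -> L2w ip (- rho) g ->
     weak_deriv ip psi g -> rpair ip v g = - rpair ip f psi) ->
  rho * wnorm ip rho v <= wnorm ip rho f.
Proof.
move=> rho0 lv lf eqn; pose a := - (2 * rho).
pose g t := f t - rscale (2 * rho) (v t).
have lrv : L2w ip rho (fun t => rscale (2 * rho) (v t)) by exact: L2wZ.
have lg : L2w ip rho g by exact: L2wB.
(* The exponential moves from [v] to the scalar test function: chi = exp (a t) phi has chi' = exp (a
   t) phi' + a chi, and the extra a chi accounts for the term - 2 rho v in [g]. *)
have wd : weak_deriv ip (reweight a v) (reweight a g).
  apply: (weak_deriv_sre hH) => h phi tphi.
  have [dchi D1 cchi' [M chi0]] := test_fun_weighted a tphi.
  set chi := fun t => _ in dchi D1 cchi' chi0.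
  have cchi := derivable_continuous dchi.
  have lchi r : L2w ip r (fun t => rscale (chi t) h).
    apply: (@L2w_compact_support _ _ _ _ hH _ _ _ M) => //.
      exact: continuous_measurable_fun.
    exact: continuous_bounded_compact_support cchi chi0.
  have lchi' r : L2w ip r (fun t => rscale (derive1 chi t) h).
    apply: (@L2w_compact_support _ _ _ _ hH _ _ _ M).
    - exact: continuous_measurable_fun.
    - exact: continuous_bounded_compact_support cchi' (derive1_out chi0).
    - exact: derive1_out.
  (* The equation accepts only pairs related by [weak_deriv], so the classical derivative of [chi]
     is first shown to be a weak one, by parts against a second test function. *)
  have wdchi : weak_deriv ip (fun t => rscale (chi t) h)
      (fun t => rscale (derive1 chi t) h).
    apply: (weak_deriv_sre hH) => h' phi2 [dphi2 [M2 phi20]].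
    have dphi20 := dphi2 0%N; have dphi21 := dphi2 1%N.
    rewrite /= in dphi20 dphi21.
    have cphi2' := derivable_continuous dphi21.
    have cphi2 := derivable_continuous dphi20.
    have parts := integration_by_parts_compact dchi cchi' dphi20 cphi2' phi20.
    under eq_Rintegral do rewrite ripZl // mulrAC mulrC.
    under [in RHS]eq_Rintegral do rewrite ripZl // mulrAC mulrC.
    rewrite !RintegralZl //; first by rewrite parts mulrN.
      apply: (@integrable_compact_support _ _ M2).
      + apply: continuous_measurable_fun => t.
        by apply: cvgM; [exact: cchi'|exact: cphi2].
      + apply: (@continuous_bounded_compact_support _ _ M2) => [t|t Mt].
          by apply: cvgM; [exact: cchi'|exact: cphi2].
        by rewrite phi20 // mulr0.
      + by move=> t Mt; rewrite phi20 // mulr0.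
    apply: (@integrable_compact_support _ _ M2).
    + apply: continuous_measurable_fun => t.
      by apply: cvgM; [exact: cchi|exact: cphi2'].
    + apply: (@continuous_bounded_compact_support _ _ M2) => [t|t Mt].
        by apply: cvgM; [exact: cchi|exact: cphi2'].
      by rewrite (derive1_out phi20) // mulr0.
    + by move=> t Mt; rewrite (derive1_out phi20) // mulr0.
  have := eqn _ _ (lchi _) (lchi' _) wdchi.
  have -> : \int[mu]_t (rip ip (reweight a v t) h * derive1 phi t) =
      rpair ip v (fun t => rscale (derive1 chi t) h) +
      2 * rho * rpair ip v (fun t => rscale (chi t) h).
    rewrite -(rpairZr hH _ lv (lchi _)).
    rewrite -(rpairDr hH lv (lchi' _) (L2wZ hH _ (lchi _))).
    rewrite rpairE; apply: eq_Rintegral => t _.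
    rewrite ripDr // !ripZr // ripZl // D1 /chi /a; ring.
  have -> : \int[mu]_t (rip ip (reweight a g t) h * phi t) =
      rpair ip f (fun t => rscale (chi t) h) -
      2 * rho * rpair ip v (fun t => rscale (chi t) h).
    rewrite -(rpairZl hH _ lv (lchi _)) -(rpairBl hH lf lrv (lchi _)).
    rewrite rpairE; apply: eq_Rintegral => t _.
    rewrite ripZr // ripZl // /g /chi; ring.
  move=> ->; ring.
have := eqn _ _ (L2w_dual hH lv) (L2w_dual hH lg) wd.
rewrite !rpair_dual // /g.
have -> : wip ip rho v (fun t => f t - rscale (2 * rho) (v t)) =
    wip ip rho v f - 2 * rho * wip ip rho v v.
  under [X in wip _ _ _ X]eq_fun do rewrite -rscaleN1 rscaleA.
  rewrite (wipDr hH lv lf (L2wZ hH _ lv)) (wipZr hH _ lv lv); ring.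
rewrite (wipC hH _ f v) -wnorm_sqr // => E.
have := le_trans (ler_norm _) (wip_CS hH lv lf).
have := wnorm_ge0 ip rho v; set X := wnorm ip rho v in E *.
set Y := wnorm ip rho f => X0 hXY.
have [->|Xn] := eqVneq X 0; first by rewrite mulr0 wnorm_ge0.
have Xp : 0 < X by rewrite lt_neqAle eq_sym Xn.
by rewrite -(ler_pM2l Xp); lra.
Qed.

Lemma smeas_chi_pos h : smeas ip (chi_pos h).
Proof.
rewrite (_ : chi_pos h = fun t => rscale (\1_`]0, +oo[ t) h).
  apply: smeas_rscale; [exact: hH| |exact: smeas_cst].
  by apply: measurable_indic; exact: measurable_itv.
apply/funext => t; rewrite /chi_pos indicE; case: ifPn => t0.
  by rewrite mem_set ?rscale1 //= in_itv /= t0.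
by rewrite memNset ?rscale0 //= in_itv /= andbT; exact/negP.
Qed.

(** Up to the factor 2 rho, the weight on the half-line is the exponential probability density,
    whose integral is 1. *)
Lemma wnorm2_chi_pos rho h : 0 < rho ->
  wnorm2 ip rho (chi_pos h) = (rip ip h h / (2 * rho))%:E.
Proof.
move=> rho0; have r2 : 0 < 2 * rho by rewrite mulr_gt0.
have r0 : 0 <= rip ip h h / (2 * rho) by rewrite divr_ge0 ?rip_ge0 // ltW.
pose F (t : R) : \bar R :=
  ((rip ip h h / (2 * rho))%:E * (exponential_pdf (2 * rho) t)%:E)%E.
transitivity (\int[mu]_t F t)%E; last first.
  rewrite ge0_integralZl_EFin //.
  - by rewrite integral_exponential_pdf // mule1.
  - by move=> t _; rewrite lee_fin exponential_pdf_ge0 // ltW.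
  - by apply/measurable_EFinP; exact: measurable_exponential_pdf.
apply: ae_eq_integral => //.
- apply/measurable_EFinP; apply: measurable_funM.
    apply: measurable_funX; apply: measurable_hnorm => //.
    exact: smeas_chi_pos.
  exact: measurable_weight.
- apply/measurable_EFinP; apply: measurable_funM; first exact: measurable_cst.
  exact: measurable_exponential_pdf.
(* At 0 the two integrands may differ: [chi_pos] vanishes there, while the density equals 2 rho. *)
- exists [set 0]; split; first exact: measurable_set1.
    exact: lebesgue_measure_set1.
  move=> t /= nt; apply: contrapT => /eqP t0; apply: nt => _.
  rewrite /F /chi_pos -EFinM; congr EFin.
  case: ltgtP t0 => // [t0|t0] _.
    rewrite exponential_pdfE; last exact: ltW.
    rewrite hnorm_sqr // mulrA divfK ?gt_eqF //; congr (_ * expR _); ring.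
  by rewrite lt0_exponential_pdf // hnorm0 // expr0n mul0r mulr0.
Qed.

Lemma L2w_chi_pos rho h : 0 < rho -> L2w ip rho (chi_pos h).
Proof.
move=> rho0; split; first exact: smeas_chi_pos.
by rewrite wnorm2_chi_pos // ltry.
Qed.

Lemma wnorm_chi_pos rho h : 0 < rho ->
  wnorm ip rho (chi_pos h) = hn h / Num.sqrt (2 * rho).
Proof.
move=> rho0; rewrite /wnorm wnorm2_chi_pos //= sqrtrM ?rip_ge0 //.
by rewrite sqrtrV // mulr_ge0 // ltW.
Qed.

End Energy.

(** * Comparison of the two solutions *)

Theorem theorem5p5 (R : realType) (b : bool)
  (H : lmodType (scal R b)) (ip : H -> H -> scal R b)
  (hH : is_hilbert ip)
  (C D : R) (hC : 0 < C) (hD : 0 < D)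
  (F G : (R -> H) -> (R -> H) -> scal R b)
  (linF : lin_functional_map ip F) (linG : lin_functional_map ip G)
  (hFG : forall rho : R, Num.max C D < rho -> exists2 Kc : R, 0 < Kc &
     forall u w psi : R -> H, Cc ip u -> Cc ip w -> Cplus ip psi ->
     [/\ kabs (F u psi - F w psi)
           <= C * wnorm ip (- rho) psi * wnorm ip rho (fun t => u t - w t),
         kabs (G u psi - G w psi)
           <= D * wnorm ip (- rho) psi * wnorm ip rho (fun t => u t - w t),
         kabs (F (fun _ => 0) psi) <= Kc * wnorm ip (- rho) psi &
         kabs (G (fun _ => 0) psi) <= Kc * wnorm ip (- rho) psi])
  (rho : R) (hrho : Num.max C D < rho) (u0 w0 : H)
  (Fr Gr : (R -> H) -> R -> H)
  (hFr : cont_ext ip rho F Fr) (hGr : cont_ext ip rho G Gr)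
  (u w : R -> H)
  (hu : solves ip rho Fr u0 u) (hw : solves ip rho Gr w0 w) :
  ((wnorm ip rho (fun t => u t - w t))%:E
   <= ((2 * rho - (C + D))^-1)%:E *
      ((Num.sqrt (2 * rho) * hnorm ip (u0 - w0))%:E
       + 2%:E * ereal_sup [set (wnorm ip rho (fun t => Fr x t - Gr x t))%:E
                          | x in L2w ip rho]))%E.
Proof.
have [[FrL _ _] [GrL _ _]] := (hFr, hGr).
have [[lu equ] [lw eqw]] := (hu, hw).
have [lC lD] : C < rho /\ D < rho by move: hrho; rewrite gt_max => /andP[].
have rho0 : 0 < rho := lt_trans hC lC.
have r2 : 0 < 2 * rho by rewrite mulr_gt0.
have [Kc _ bounds] := hFG rho hrho.
have lipF : forall x y, L2w ip rho x -> L2w ip rho y ->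
    wnorm ip rho (fun t => Fr x t - Fr y t)
      <= C * wnorm ip rho (fun t => x t - y t).
  apply: (cont_ext_lipschitz hH (ltW hC) hFr) => x y psi cx cy cpsi.
  by have [h _ _ _] := bounds _ _ _ cx cy cpsi; exact: h.
have lipG : forall x y, L2w ip rho x -> L2w ip rho y ->
    wnorm ip rho (fun t => Gr x t - Gr y t)
      <= D * wnorm ip rho (fun t => x t - y t).
  apply: (cont_ext_lipschitz hH (ltW hD) hGr) => x y psi cx cy cpsi.
  by have [_ h _ _] := bounds _ _ _ cx cy cpsi; exact: h.
set S := ereal_sup _.
have sup x : L2w ip rho x ->
    ((wnorm ip rho (fun t => Fr x t - Gr x t))%:E <= S)%E.
  by move=> lx; apply: ereal_sup_ubound; exists x.
(* The point [u] makes the set nonempty, which excludes a supremum equal to -oo. *)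
have S0 : (0 <= S)%E.
  by apply: le_trans (sup u lu); rewrite lee_fin wnorm_ge0.
have inv0 : 0 < (2 * rho - (C + D))^-1 by rewrite invr_gt0; lra.
(* If the supremum is +oo, so is the right-hand side, its factors being positive; below, the
   supremum is a real [s]. *)
case: S sup S0 => [s||//] sup _; last first.
  by rewrite gt0_muley ?lte_fin // addey // gt0_muley ?lte_fin // leey.
have su := sup u lu; have sw := sup w lw; rewrite !lee_fin in su sw.
rewrite -(EFinM 2 s) -EFinD -EFinM lee_fin.
pose z t := chi_pos u0 t - chi_pos w0 t : H.
pose v t := (u t - w t) - z t; pose f t := Fr u t - Gr w t.
have lu0 : L2w ip rho (chi_pos u0) := L2w_chi_pos hH u0 rho0.
have lw0 : L2w ip rho (chi_pos w0) := L2w_chi_pos hH w0 rho0.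
have lz : L2w ip rho z := L2wB hH lu0 lw0.
have luw : L2w ip rho (fun t => u t - w t) := L2wB hH lu lw.
have lv : L2w ip rho v := L2wB hH luw lz.
have lFu := FrL u lu; have lFw := FrL w lw.
have lGu := GrL u lu; have lGw := GrL w lw.
have lf : L2w ip rho f := L2wB hH lFu lGw.
have energy : rho * wnorm ip rho v <= wnorm ip rho f.
  apply: (energy_estimate hH rho0 lv lf) => psi g lpsi lg wd.
  have rN x : L2w ip rho x -> rpair ip x (fun t => - g t) = - rpair ip x g.
    move=> lx; rewrite -mulN1r -(rpairZr hH _ lx lg).
    by under [in RHS]eq_fun do rewrite rscaleN1.
  (* In both equations the delta term is the pairing of [chi_pos] with [- g], so subtracting [z]
     cancels it exactly. *)
  have := congr1 (@sre R b) (equ psi g lpsi lg wd).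
  have := congr1 (@sre R b) (eqw psi g lpsi lg wd).
  rewrite !sreD -!/(rpair _ _ _) !rN // /v /z /f.
  rewrite (rpairBl hH luw lz lg) (rpairBl hH lu lw lg).
  by rewrite (rpairBl hH lu0 lw0 lg) (rpairBl hH lFu lGw lpsi); lra.
have zE : wnorm ip rho z = hnorm ip (u0 - w0) / Num.sqrt (2 * rho).
  rewrite -(wnorm_chi_pos hH _ rho0); congr (wnorm _ _ _); apply/funext => t.
  by rewrite /z /chi_pos; case: ifP; rewrite ?subrr.
set X := wnorm ip rho (fun t => u t - w t).
have tri : X <= wnorm ip rho v + wnorm ip rho z.
  apply: le_trans (wnormD hH lv lz).
  by under [in leRHS]eq_fun do rewrite subrK.
(* The intermediate point is [Fr w] here and [Gr u] in the next bound, so the supremum is used at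
   [w] and at [u] respectively. *)
have fC : wnorm ip rho f <= C * X + s.
  apply: le_trans (wnorm_trans hH lFu lFw lGw) _.
  exact: lerD (lipF _ _ lu lw) sw.
have fD : wnorm ip rho f <= D * X + s.
  apply: le_trans (wnorm_trans hH lFu lGu lGw) _.
  by rewrite addrC; exact: lerD (lipG _ _ lu lw) su.
have sq : Num.sqrt (2 * rho) * hnorm ip (u0 - w0) = 2 * rho * wnorm ip rho z.
  have q0 : 0 < Num.sqrt (2 * rho) by rewrite sqrtr_gt0.
  have := sqr_sqrtr (ltW r2); rewrite zE.
  move: (Num.sqrt _) q0 => q q0 <-.
  by field; rewrite gt_eqF.
rewrite ler_pdivlMl; last by rewrite -invr_gt0.
rewrite sq; move: X (wnorm ip rho v) (wnorm ip rho z) (wnorm ip rho f)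
  energy tri fC fD => X V Z Y energy tri fC fD.
(* Twice this inequality, with [energy] and the sum of [fC] and [fD], reads 2 rho X <= (C + D) X + 2
   s + 2 rho Z. *)
have : rho * X <= rho * (V + Z) by rewrite ler_pM2l.
lra.
Qed.
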